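(* Let $n,r\ge 1$ be integers. The $\mathbb{Z}$-algebras $G(n,r)$ and $S_q(n,r)_{q=0}=S_0(n,r)$ are isomorphic.
   Context: Flags and orbits. Let $k$ be a field and $V$ an $r$-dimensional $k$-vector space. $\mathcal{F}$ is the set (variety) of $n$-step flags $f:\{0\}=V_0\subseteq V_1\subseteq\cdots\subseteq V_n=V$. $\mathrm{GL}(V)$ acts on $\mathcal{F}$ and diagonally on $\mathcal{F}\times\mathcal{F}$; $[f,f']$ is the $\mathrm{GL}(V)$-orbit of $(f,f')$. For $f=(V_i)$, $f'=(V'_i)$ put $A(f,f')_{ij}=\dim(V_{i-1}+V_i\cap V'_j)-\dim(V_{i-1}+V_i\cap V'_{j-1})$. This gives a bijection between $\mathrm{GL}(V)$-orbits in $\mathcal{F}\times\mathcal{F}$ and $n\times n$ matrices of non-negative integers with entries summing to $r$; $e_A$ denotes the orbit with matrix $A$. $q$-Schur algebra (Beilinson–Lusztig–MacPherson). For matrices $A,A',A''$ there is a polynomial $g_{A,A',A''}\in\mathbb{Z}[q]$ such that over every finite field $k$, with $|k|$ elements, and any $(f_1,f_2)\in e_{A''}$, the value of $g_{A,A',A''}$ at $|k|$ is the number of $f\in\mathcal{F}$ with $(f_1,f)\in e_A$ and $(f,f_2)\in e_{A'}$. $S_q(n,r)$ is the free $\mathbb{Z}[q]$-module with basis the symbols $e_A$ and associative multiplication $e_Ae_{A'}=\sum_{A''}g_{A,A',A''}e_{A''}$. The $0$-Schur algebra is $S_0(n,r)=S_q(n,r)\otimes_{\mathbb{Z}[q]}\mathbb{Z}[q]/(q)$.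 Generic algebra. Let $k$ be algebraically closed. For orbits $e_A,e_{A'}$ let $S(A,A')=\{(f_1,f_2)\in\mathcal{F}\times\mathcal{F}: \exists f\in\mathcal{F},\ (f_1,f)\in e_A,\ (f,f_2)\in e_{A'}\}$. If non-empty, $S(A,A')$ contains a unique $\mathrm{GL}(V)$-orbit that is open in it (Zariski topology). $G(n,r)$ is the free $\mathbb{Z}$-module with basis the orbits $e_A$ and bilinear product $e_A\star e_{A'}=e_{A''}$, where $e_{A''}$ is the open orbit in $S(A,A')$, if $S(A,A')\ne\emptyset$, and $e_A\star e_{A'}=0$ otherwise. This is an associative $\mathbb{Z}$-algebra. *)

(* Defs.v *)
From HB Require Import structures.
From mathcomp Require Import all_boot all_order all_algebra.
From mathcomp Require Import boolp classical_sets.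
From mathcomp Require Import mpoly.

Set Implicit Arguments.
Unset Strict Implicit.
Unset Printing Implicit Defensive.

Import GRing.Theory.
Local Open Scope ring_scope.

(* An R-algebra that is free as an R-module, given by a finite basis [scbasis]
   and structure constants: e_a * e_b = \sum_c (sc a b c) e_c. Neither
   associativity nor a unit is built in; an isomorphism transports both. *)
Record scalg (R : comNzRingType) := ScAlg {
  scbasis : finType;
  sc : scbasis -> scbasis -> scbasis -> R
}.

Definition sccarrier (R : comNzRingType) (S : scalg R) :=
  {ffun scbasis S -> R^o}.

Definition scmul (R : comNzRingType) (S : scalg R) (x y : sccarrier S) :
    sccarrier S :=
  [ffun c => \sum_(a : scbasis S) \sum_(b : scbasis S) x a * y b * sc a b c].

(* S ⊗_R R' along phi : R -> R'; it is R'-free on the same basis. *)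
Definition scbasechange (R R' : comNzRingType) (phi : {rmorphism R -> R'})
    (S : scalg R) : scalg R' :=
  @ScAlg R' (scbasis S) (fun a b c => phi (sc a b c)).

Definition scisomorphic (R : comNzRingType) (S T : scalg R) : Prop :=
  exists phi : {linear {ffun scbasis S -> R^o} -> {ffun scbasis T -> R^o}},
    bijective phi /\
    forall x y : sccarrier S, phi (scmul x y) = scmul (phi x) (phi y).

Section Flags.
Variables (k : fieldType) (V : vectType k) (n : nat).

Definition is_flag (f : {ffun 'I_n.+1 -> {vspace V}}) : bool :=
  [&& f ord0 == 0%VS, f ord_max == fullv
    & [forall i : 'I_n, (f (widen_ord (leqnSn n) i) <= f (lift ord0 i))%VS]].

Definition flag := {f : {ffun 'I_n.+1 -> {vspace V}} | is_flag f}.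

(* For i : 'I_n, standing for the 1-based index i + 1, [fstep f i] is V_(i+1)
   and [fprev f i] is V_i. *)
Definition fstep (f : flag) (i : 'I_n) : {vspace V} := val f (lift ord0 i).
Definition fprev (f : flag) (i : 'I_n) : {vspace V} :=
  val f (widen_ord (leqnSn n) i).

(* The truncated subtraction is harmless: the second space is contained in the
   first. *)
Definition relpos (f f' : flag) : 'M[nat]_n :=
  \matrix_(i, j)
    (\dim (fprev f i + (fstep f i :&: fstep f' j))
     - \dim (fprev f i + (fstep f i :&: fprev f' j)))%N.

(* q is the translate of p by g in GL(V), for the diagonal action. *)
Definition translate (g : 'End(V)) (p q : flag * flag) : Prop :=
  forall i : 'I_n.+1, val q.1 i = (g @: val p.1 i)%VS
                   /\ val q.2 i = (g @: val p.2 i)%VS.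

Definition orbit (p : flag * flag) : set (flag * flag) :=
  [set q | exists2 g : 'End(V), lker g == 0%VS & translate g p q].

End Flags.

(* n x n matrices of non-negative integers with sum r; each entry is then at
   most r, which makes this a finite type. *)
Definition summx (n r : nat) :=
  {A : 'M['I_r.+1]_n | (\sum_i \sum_j A i j)%N == r}.

Definition natmx_of n r (A : summx n r) : 'M[nat]_n :=
  map_mx (@nat_of_ord r.+1) (val A).

(* e_A, the orbit whose pairs have relative position A. *)
Definition eorb (k : fieldType) (V : vectType k) (n r : nat) (A : summx n r) :
    set (flag V n * flag V n) :=
  [set q | exists2 p, relpos p.1 p.2 = natmx_of A & orbit p q].

(* Needed for the subType structure of {vspace V} over matrices. *)
Import VectorInternalTheory.
HB.instance Definition _ (k : finFieldType) (V : vectType k) :=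
  [Countable of @space k V by <:].
HB.instance Definition _ (k : finFieldType) (V : vectType k) :=
  [Finite of @space k V by <:].

Section QSchur.
Variables n r : nat.

Definition hall_spec (A A' A'' : summx n r) : set {poly int} :=
  [set g | forall (k : finFieldType) (V : vectType k), \dim {:V} = r ->
     forall f1 f2 : flag V n, eorb A'' (f1, f2) ->
     g.[#|k|%:R] = #|[pred f : flag V n | `[< eorb A (f1, f) >]
                                       && `[< eorb A' (f, f2) >]]|%:R].

(* The polynomial g_{A,A',A''}. It exists, and it is unique because there are
   finite fields of arbitrarily large order; the default 0 is never used. *)
Definition hall_poly (A A' A'' : summx n r) : {poly int} :=
  xget 0 (hall_spec A A' A'').

Definition qSchur : scalg {poly int} := ScAlg hall_poly.

(* Z[q]/(q) is identified with Z, the projection being evaluation at q = 0. *)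
Definition zeroSchur : scalg int :=
  scbasechange (horner_eval (0 : int)) qSchur.

End QSchur.

Section Zariski.
Variables (k : fieldType) (V : vectType k) (n : nat).

(* The Plücker coordinates of U in the basis [vbasis fullv] of V, as a point of
   P(ΛV): the coordinate at T is the minor on the columns in T of a basis
   matrix of U if #|T| = \dim U, and 0 otherwise. *)
Definition plucker (U : {vspace V}) (T : {set 'I_(\dim {:V})}) : k :=
  if #|T| == \dim U then
    \det (\matrix_(a < #|T|, b < #|T|)
            coord (vbasis fullv) (enum_val b) (vbasis U)`_a)
  else 0.

(* F x F is embedded in the product of 2(n+1) copies of P(ΛV), indexed by the
   side (true for the first flag) and the step. The image of each product of
   two flag varieties of fixed types is closed, and these finitely many images
   are pairwise disjoint. *)
Definition pblock : finType := (bool * 'I_n.+1)%type.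
Definition pvar : finType := (pblock * {set 'I_(\dim {:V})})%type.

Definition pcoord (p : flag V n * flag V n) (v : pvar) : k :=
  let: (s, i, T) := v in plucker (val (if s then p.1 else p.2) i) T.

Definition multihomogeneous (P : {mpoly k[#|pvar|]}) : Prop :=
  forall b : pblock, exists d : nat, forall m, m \in msupp P ->
    (\sum_(T : {set 'I_(\dim {:V})}) m (enum_rank ((b, T) : pvar)))%N = d.

Definition zariski_closed (Z : set (flag V n * flag V n)) : Prop :=
  exists2 Ps : set {mpoly k[#|pvar|]},
    forall P, Ps P -> multihomogeneous P &
    forall p, Z p <->
      forall P, Ps P -> P.@[fun v => pcoord p (enum_val v)] = 0.

Definition open_in (S U : set (flag V n * flag V n)) : Prop :=
  exists2 Z, zariski_closed Z & U = (S `\` Z)%classic.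

End Zariski.

Section Generic.
Variables (k : closedFieldType) (V : vectType k) (n r : nat).

Definition Sset (A A' : summx n r) : set (flag V n * flag V n) :=
  [set p | exists f : flag V n, eorb A (p.1, f) /\ eorb A' (f, p.2)].

(* The coefficient of e_A'' in e_A * e_A': 1 if e_A'' is the open orbit in
   S(A,A'), and 0 otherwise; e_A'' is never empty when V has dimension r, so all
   coefficients vanish if S(A,A') is empty. *)
Definition generic_sc (A A' A'' : summx n r) : int :=
  (`[< open_in (Sset A A') (@eorb k V n r A'') >] : nat)%:R.

Definition generic_alg : scalg int := ScAlg generic_sc.

End Generic.

(* Main.v *)
Require Import Defs.
From HB Require Import structures.
From mathcomp Require Import all_boot all_order all_algebra.
From mathcomp Require Import boolp classical_sets.
From mathcomp Require Import perm mpoly.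
From mathcomp Require Import zify ring.

Set Implicit Arguments.
Unset Strict Implicit.
Unset Printing Implicit Defensive.

Import GRing.Theory.
Local Open Scope nat_scope.

(** The isomorphism sends e_A to the sum of the e_B with B <= A, where B <= A means
    that the steps of the flags have the same dimensions in both positions and that the
    intersections V_i :&: V'_j are at least as large in position B as in position A. This
    map is unitriangular ([zeta_bijective]). It is multiplicative if and only if, for all
    A, A' and C, the sum of the constant terms of the Hall polynomials g_(B,B',C) over all
    B <= A and B' <= A' is 1 when e_A * e_A' is nonzero in the generic algebra, equal to e_D
    with C <= D, and is 0 otherwise ([structure_constants]).

    Refine the first flag of a pair (f1, f) to a complete flag F. The position of F relative
    to f is a word w, and the rank order becomes the Bruhat order on words. Replacing one
    step of F moves F in a projective line, on which the word relative to f is constant or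
    takes two values: one member has the letters s and s.+1 in ascending order, all the
    others have them in descending order ([pencil]). Since [dn s u <= w] if and only if
    [u <= up s w] ([dn_up_adj]), the number of members with word at most w is, modulo the
    order q of the field, 1 or 0 according to whether the word of F is at most [up s w].
    Every word arises from an ascending one by such exchanges ([word_ind]), and if the word
    is ascending then F determines f. Going through the exchanges one at a time thus
    computes, modulo q, the number of f with (F, f) at most w and (f, f2) at most A': it is 1
    if (F, f2) is at most the word W obtained from the same exchanges, and 0 otherwise
    ([demazure_count]). Matrices correspond to words that descend on the blocks given by the
    dimensions of f1 ([rep], [mle_wle]), and the matrix D of W is the generic product of A
    and A' ([isprod]).

    The same recursion, with equality instead of <=, shows that the Hall polynomials exist
    ([hall_word], [hall_exists]). An integral polynomial has congruent values at 0 and at a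
    prime p modulo p; so the congruences over all prime fields determine the sums of constant
    terms ([zero_sum_prod]).

    Over an algebraically closed field, the argument with existence instead of counting
    shows that the pairs with a middle flag in positions at most A and at most A' are those
    in position at most D ([prod_closorb]); and a pair in position D has a middle flag in
    positions exactly A and A' ([prod_attained]). So the orbit of D is the part of S(A, A')
    where no intersection is larger than necessary, which is an open condition
    ([prod_open]). It is the only open orbit, because any two points of S(A, A') can be
    joined, up to the action of GL(V), by a rational curve in S(A, A') ([open_unique]). *)

(** * Words and their rank functions *)

(** If [w] is the word of a complete flag [F] relative to a flag [f], this is
    the dimension of the intersection of [F a] and the step [j] of [f]; see
    [dim_rk]. *)
Definition rk (w : nat -> nat) (a j : nat) := \sum_(b < a) (w b < j).

(** A word of length [r] in the letters [0 .. n - 1] is a function on all of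
    [nat], constant from [r] on, so that equality of words is equality of
    functions. The constant [n] is the value that [word] below takes there. *)
Definition is_word r n (w : nat -> nat) :=
  (forall b, b < r -> w b < n) /\ (forall b, r <= b -> w b = n).

(** The Bruhat order on words with the same letters: a smaller word has larger
    intersections, hence is more special. *)
Definition wle r (u w : nat -> nat) :=
  (forall a j, a <= r -> rk w a j <= rk u a j) /\
  (forall j, rk u r j = rk w r j).

(** [dn s] and [up s] put the letters at [s] and [s.+1] in ascending and in
    descending order; [up s] is the action of a generator of the 0-Hecke
    monoid on words. *)
Definition dn s (w : nat -> nat) b :=
  if b == s then minn (w s) (w s.+1)
  else if b == s.+1 then maxn (w s) (w s.+1) else w b.

Definition up s (w : nat -> nat) b :=
  if b == s then maxn (w s) (w s.+1)
  else if b == s.+1 then minn (w s) (w s.+1) else w b.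

Lemma rk0 w j : rk w 0 j = 0. Proof. by rewrite /rk big_ord0. Qed.

Lemma rkS w a j : rk w a.+1 j = rk w a j + (w a < j).
Proof. by rewrite /rk big_ord_recr. Qed.

Lemma rk_letter r w w' :
    (forall a j, a <= r -> rk w a j = rk w' a j) ->
  forall b, b < r -> w b = w' b.
Proof.
move=> e b br; have E j : (w b < j) = (w' b < j).
  have := e b.+1 j br; rewrite !rkS (e b j (ltnW br)) => /addnI.
  by case: (w b < j); case: (w' b < j).
by have := E (w b).+1; have := E (w' b).+1; lia.
Qed.

Lemma rk_ge_n r n w a j : is_word r n w -> a <= r -> n <= j -> rk w a j = a.
Proof.
move=> [h _]; elim: a => [|a IH] ar nj; first by rewrite rk0.
by rewrite rkS IH ?(leq_trans (h a ar) nj) ?addn1 // ltnW.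
Qed.

Lemma is_word_eq r n w w' : is_word r n w -> is_word r n w' ->
  (forall b, b < r -> w b = w' b) -> w = w'.
Proof.
move=> [_ h] [_ h'] e; apply/funext => b.
by case: (ltnP b r) => [/e//|rb]; rewrite h ?h'.
Qed.

Lemma wle_refl r w : wle r w w. Proof. by []. Qed.

Lemma wle_trans r u v w : wle r u v -> wle r v w -> wle r u w.
Proof.
move=> [h1 h2] [h3 h4]; split=> [a j ar|j]; last by rewrite h2 h4.
exact: leq_trans (h3 a j ar) (h1 a j ar).
Qed.

Lemma wle_anti r n u w : is_word r n u -> is_word r n w ->
  wle r u w -> wle r w u -> u = w.
Proof.
move=> wu ww [h1 _] [h2 _]; apply: is_word_eq wu ww _.
by apply: rk_letter => a j ar; apply/eqP; rewrite eqn_leq h1 ?h2.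
Qed.

Lemma is_word_up r n s w : s.+1 < r -> is_word r n w -> is_word r n (up s w).
Proof.
move=> sr [h1 h2]; split=> b br; rewrite /up.
  have := h1 s; have := h1 s.+1; have := h1 b br.
  by case: eqP => ?; [|case: eqP => ?]; lia.
by rewrite -(h2 b br); case: eqP => ?; [|case: eqP => ?]; lia.
Qed.

Lemma is_word_dn r n s w : s.+1 < r -> is_word r n w -> is_word r n (dn s w).
Proof.
move=> sr [h1 h2]; split=> b br; rewrite /dn.
  have := h1 s; have := h1 s.+1; have := h1 b br.
  by case: eqP => ?; [|case: eqP => ?]; lia.
by rewrite -(h2 b br); case: eqP => ?; [|case: eqP => ?]; lia.
Qed.

(** Only the rank at [s.+1] sees the order of the letters at [s] and [s.+1]. *)
Lemma rk_off s w w' a j :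
    (forall b, b != s -> b != s.+1 -> w' b = w b) ->
    (w' s < j) + (w' s.+1 < j) = (w s < j) + (w s.+1 < j) ->
  a != s.+1 -> rk w' a j = rk w a j.
Proof.
move=> e es ha; elim: a {-2}a (leqnn a) ha => [|m IH] a am ha.
  by (have -> : a = 0 by lia); rewrite !rk0.
case: a am ha => [|a] am ha; first by rewrite !rk0.
have [eas|nas] := eqVneq a s.+1.
  rewrite eas !rkS; rewrite IH; [|lia|lia].
  by have := es; lia.
rewrite !rkS; rewrite IH; [|lia|lia]; rewrite e; lia.
Qed.

Lemma rk_up_off s w a j : a != s.+1 -> rk (up s w) a j = rk w a j.
Proof.
apply: rk_off => [b /negPf h1 /negPf h2|]; first by rewrite /up h1 h2.
by rewrite /up !eqxx (_ : s.+1 == s = false); lia.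
Qed.

Lemma rk_dn_off s w a j : a != s.+1 -> rk (dn s w) a j = rk w a j.
Proof.
apply: rk_off => [b /negPf h1 /negPf h2|]; first by rewrite /dn h1 h2.
by rewrite /dn !eqxx (_ : s.+1 == s = false); lia.
Qed.

Lemma rk_up_on s w j :
  rk (up s w) s.+1 j = maxn (rk w s j) (rk w s.+2 j).-1.
Proof. by rewrite !rkS (rk_up_off w j) /up ?eqxx; lia. Qed.

Lemma rk_dn_on s w j :
  rk (dn s w) s.+1 j = minn (rk w s j).+1 (rk w s.+2 j).
Proof. by rewrite !rkS (rk_dn_off w j) /dn ?eqxx; lia. Qed.

Lemma rk_up_le s w a j : rk (up s w) a j <= rk w a j.
Proof.
have [->|h] := eqVneq a s.+1; last by rewrite rk_up_off.
by rewrite rk_up_on !rkS; lia.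
Qed.

Lemma wle_up r s w : s.+1 < r -> wle r w (up s w).
Proof.
move=> sr; split=> [a j _|j]; first exact: rk_up_le.
by rewrite rk_up_off //; lia.
Qed.

(** Both sides say that [u] satisfies the rank conditions of [w] away from
    [s.+1]. Indeed the rank of [up s w] at [s.+1] is the least one that its
    values at [s] and [s.+2] permit, and that of [dn s u] is the greatest one. *)
Lemma dn_up_adj r s u w : s.+1 < r -> wle r (dn s u) w <-> wle r u (up s w).
Proof.
move=> sr; split=> -[h1 h2]; split=> [a j ar|j].
- have [->|h] := eqVneq a s.+1; last first.
    by have := h1 a j ar; rewrite rk_dn_off ?rk_up_off.
  have := h1 s j; have := h1 s.+2 j.
  by rewrite rk_up_on !rk_dn_off 1?rkS 1?(rkS u) ?rkS; lia.
- by have := h2 j; rewrite rk_dn_off ?rk_up_off //; lia.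
- have [->|h] := eqVneq a s.+1; last first.
    by have := h1 a j ar; rewrite rk_dn_off ?rk_up_off.
  have := h1 s j; have := h1 s.+2 j.
  by rewrite rk_dn_on !rk_up_off ?rkS; lia.
- by have := h2 j; rewrite rk_dn_off ?rk_up_off //; lia.
Qed.

Lemma up_idem s w : w s.+1 <= w s -> up s w = w.
Proof.
move=> h; apply/funext => b; rewrite /up; case: eqP => [->|_]; first lia.
by case: eqP => [->|//]; lia.
Qed.

Lemma dn_idem s w : w s <= w s.+1 -> dn s w = w.
Proof.
move=> h; apply/funext => b; rewrite /dn; case: eqP => [->|_]; first lia.
by case: eqP => [->|//]; lia.
Qed.

Lemma up_dn s w : up s (dn s w) = up s w.
Proof.
apply/funext => b; rewrite /up /dn !eqxx; have -> : (s.+1 == s) = false by lia.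
by case: eqP => // _; [lia | case: eqP => //; lia].
Qed.

Lemma dn_up s w : dn s (up s w) = dn s w.
Proof.
apply/funext => b; rewrite /up /dn !eqxx; have -> : (s.+1 == s) = false by lia.
by case: eqP => // _; [lia | case: eqP => //; lia].
Qed.

Lemma dn_wle r s u : s.+1 < r -> wle r (dn s u) u.
Proof.
by move=> sr; apply/dn_up_adj => //; apply: wle_up.
Qed.

Lemma up_neq s w : w s < w s.+1 -> up s w <> w.
Proof. by move=> h /(congr1 (fun w => w s)); rewrite /up eqxx; lia. Qed.

Definition ascending r (w : nat -> nat) :=
  forall b, b.+1 < r -> w b <= w b.+1.

(** A statistic that strictly increases when [up s] acts nontrivially. *)
Definition weight r (w : nat -> nat) := \sum_(b < r) (r - b) * w b.

Lemma weight_up r s w : s.+1 < r -> w s < w s.+1 -> weight r w < weight r (up s w).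
Proof.
move=> sr h.
have s0 : s < r by lia.
rewrite /weight (bigD1 (Ordinal s0)) //= (bigD1 (Ordinal sr)) /=; last first.
  by rewrite -val_eqE /=; lia.
rewrite [X in _ < X](bigD1 (Ordinal s0)) //= [X in _ < _ + X](bigD1 (Ordinal sr)) /=; last first.
  by rewrite -val_eqE /=; lia.
set A := \sum_(i < r | _) _; set B := \sum_(i < r | _) _.
have -> : B = A.
  apply: eq_bigr => i; rewrite -!val_eqE /= => /andP[/negPf h1 /negPf h2].
  by rewrite /up h1 h2.
rewrite !addnA ltn_add2r /up !eqxx; have -> : (s.+1 == s) = false by lia.
have -> : maxn (w s) (w s.+1) = w s.+1 by lia.
have -> : minn (w s) (w s.+1) = w s by lia.
have -> : r - s = (r - s.+1).+1 by lia.
rewrite !mulSn; lia.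
Qed.

Lemma up_dn_asc s w : w s.+1 < w s -> up s (dn s w) = w.
Proof. by move=> h; rewrite up_dn up_idem //; lia. Qed.

Lemma is_word_of_up r n s w : s.+1 < r -> w s < w s.+1 ->
  is_word r n (up s w) -> is_word r n w.
Proof. by move=> sr h /(is_word_dn sr); rewrite dn_up dn_idem // ltnW. Qed.

(** Bubble sort read backwards: every word comes from an ascending one by
    exchanging, one pair at a time, ascending neighbours. *)
Lemma word_ind r n (P : (nat -> nat) -> Prop) :
    (forall w, is_word r n w -> ascending r w -> P w) ->
    (forall s w, s.+1 < r -> w s < w s.+1 -> is_word r n w -> P w -> P (up s w)) ->
  forall w, is_word r n w -> P w.
Proof.
move=> P0 PS w; have [m] := ubnP (weight r w); elim: m w => // m IH w hm ww.
have [asc|/existsNP[s /not_implyP[sr /negP hs]]] := pselect (ascending r w).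
  exact: P0.
have h : w s.+1 < w s by lia.
(* Undo an exchange at a descent. *)
have wd : is_word r n (dn s w) by apply: is_word_dn.
have hd : dn s w s < dn s w s.+1.
  by rewrite /dn !eqxx; (have -> : (s.+1 == s) = false by lia); lia.
rewrite -(up_dn_asc h); apply: PS => //; apply: IH => //.
by have := weight_up sr hd; rewrite (up_dn_asc h); lia.
Qed.

(** [demazure r v w W] says that a reduced expression that sorts [w] down to
    an ascending word, applied in the 0-Hecke monoid to [v], gives [W]. It
    replaces the Demazure product of permutations and handles repeated
    letters. *)
Inductive demazure r (v : nat -> nat) : (nat -> nat) -> (nat -> nat) -> Prop :=
| DemazureBase w : ascending r w -> demazure r v w v
| DemazureStep s w W : s.+1 < r -> w s < w s.+1 ->
    demazure r v w W -> demazure r v (up s w) (up s W).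

Lemma demazure_ex r n v w : is_word r n v -> is_word r n w ->
  exists2 W, is_word r n W & demazure r v w W.
Proof.
move=> wv; move: w; apply: word_ind => [w _ aw|s w sr h _ [W wW DW]].
  by exists v => //; apply: DemazureBase.
by exists (up s W); [apply: is_word_up | constructor].
Qed.

Lemma rk_le w a j : rk w a j <= a.
Proof. by elim: a => [|a IH]; rewrite ?rk0 ?rkS //; case: (_ < j); lia. Qed.

Lemma rk_mono w a c j : a <= c -> rk w a j <= rk w c j.
Proof.
elim: c => [|c IH]; first by rewrite leqn0 => /eqP->; lia.
by rewrite leq_eqVlt => /orP[/eqP->|h]; [lia | have := IH h; rewrite rkS; lia].
Qed.

Lemma rk_lip w a c j : a <= c -> rk w c j <= rk w a j + (c - a).
Proof.
elim: c => [|c IH]; first by rewrite leqn0 => /eqP->; lia.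
by rewrite leq_eqVlt => /orP[/eqP->|h]; [lia | have := IH h; rewrite rkS; lia].
Qed.

(** An ascending word is a string of letters below [j] followed by a string of
    letters that are not. *)
Lemma rk_asc r w a j : ascending r w -> a <= r -> rk w a j = minn a (rk w r j).
Proof.
move=> asc ar.
have mono b c : b <= c -> c < r -> w b <= w c.
  elim: c => [|c IH] bc cr; first by have -> : b = 0 by lia.
  move: bc; rewrite leq_eqVlt => /orP[/eqP->//|bc].
  by apply: leq_trans (asc c cr); apply: IH; lia.
have [lo|hi] := boolP (all (fun b => w b < j) (iota 0 a)).
  have : rk w a j = a.
    elim: a lo {ar} => [|a IH]; first by rewrite rk0.
    by rewrite -[in iota _ _]addn1 iotaD all_cat /= rkS => /andP[/IH-> /andP[-> _]]; lia.
  by have := rk_mono w j ar; lia.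
have [b] : exists2 b, b < a & j <= w b.
  move/allPn: hi => [b]; rewrite mem_iota => /andP[_ h] h'.
  by exists b => //; rewrite leqNgt.
move=> ba jb; suff : rk w r j = rk w a j by have := rk_le w a j; lia.
have : forall c, a <= c -> c <= r -> rk w c j = rk w a j.
  elim=> [|c IH] ac cr; first by have -> : a = 0 by lia.
  move: ac; rewrite leq_eqVlt => /orP[/eqP->//|ac].
  rewrite rkS IH; [|lia|lia]; have := mono b c; lia.
by apply.
Qed.

(** Among the words with prescribed ranks at the positions [lam i], the one
    that weakly descends on each block from [lam i] to [lam i.+1] is the
    largest; see [blockdesc_wle]. *)
Definition blockdesc n (lam : nat -> nat) (w : nat -> nat) :=
  forall i b, i < n -> lam i <= b -> b.+1 < lam i.+1 -> w b.+1 <= w b.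

(** On a block of [w] the letters below [j] come last, so the rank of [w]
    inside the block is the least one that its values at the two ends permit.
    Conditions at the ends of the blocks therefore suffice. *)
Lemma blockdesc_wle r n lam u w :
    lam 0 = 0 -> lam n = r -> (forall i, i < n -> lam i <= lam i.+1) ->
    blockdesc n lam w ->
    (forall i j, i <= n -> rk w (lam i) j <= rk u (lam i) j) ->
    (forall j, rk u r j = rk w r j) ->
  wle r u w.
Proof.
move=> l0 ln lm bd h hr; split=> // a j ar.
have [i [ilt la al]] : exists i, [/\ i <= n, lam i <= a & i = n \/ a < lam i.+1].
  have : exists i, (i <= n) && (lam i <= a) by exists 0; rewrite l0.
  move=> ex; have ub : forall i, (i <= n) && (lam i <= a) -> i <= n by move=> i /andP[].
  case: (ex_maxnP ex ub) => i /andP[h1 h2] mx; exists i; split=> //.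
  case: (ltngtP i n) h1 => // [h1 _|->]; last by left.
  by right; rewrite ltnNge; apply/negP => h3; have := mx i.+1; rewrite h1 h3; lia.
have [ain|nin] : i = n \/ i < n by lia.
  have -> : a = r by move: la; rewrite ain ln; lia.
  by rewrite hr.
have al' : a < lam i.+1 by case: al => //; lia.
have mono b c : lam i <= b -> b <= c -> c < lam i.+1 -> w c <= w b.
  elim: c => [|c IH] lb bc cr; first by have -> : b = 0 by lia.
  move: bc; rewrite leq_eqVlt => /orP[/eqP->//|bc].
  by apply: leq_trans (bd i c nin _ _) (IH _ _ _); lia.
have [lo|[b [b1 b2 b3]]] : (forall b, lam i <= b -> b < a -> j <= w b) \/
    exists b, [/\ lam i <= b, b < a & w b < j].
  have [p|/existsNP[b /not_implyP[b1 /not_implyP[b2 b3]]]] :=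
    pselect (forall b, lam i <= b -> b < a -> j <= w b); [by left|right].
  by exists b; split=> //; rewrite ltnNge; apply/negP.
  have : forall c, lam i <= c -> c <= a -> rk w c j = rk w (lam i) j.
    elim=> [|c IH] ac cr; first by (have -> : lam i = 0 by lia).
    move: ac; rewrite leq_eqVlt => /orP[/eqP->//|ac].
    rewrite rkS IH; [|lia|lia]; have := lo c; lia.
  move=> ->//; apply: leq_trans (h i j _) _; first lia.
  by apply: rk_mono; lia.
have : forall c, a <= c -> c <= lam i.+1 -> rk w c j = rk w a j + (c - a).
  elim=> [|c IH] ac cr; first by (have -> : a = 0 by lia); lia.
  move: ac; rewrite leq_eqVlt => /orP[/eqP->|ac]; first lia.
  rewrite rkS IH; [|lia|lia]; have := mono b c; lia.
move=> /(_ (lam i.+1) (ltnW al') (leqnn _)).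
have := h i.+1 j nin; have := rk_lip u j (ltnW al'); lia.
Qed.

Lemma block_interior n (lam : nat -> nat) i b :
    (forall i, i < n -> lam i <= lam i.+1) -> i < n -> lam i <= b -> b.+1 < lam i.+1 ->
  forall j, j <= n -> lam j <> b.+1.
Proof.
move=> mono ni h1 h2 j nj.
have M c d : c <= d -> d <= n -> lam c <= lam d.
  elim: d => [|d IH]; first by rewrite leqn0 => /eqP->.
  rewrite leq_eqVlt => /orP[/eqP->//|cd] nd.
  by apply: leq_trans (IH _ _) (mono d nd) => //; apply: ltnW.
have [ji|ij] := leqP j i; first by have := M _ _ ji (ltnW ni); lia.
by have := M _ _ ij nj; lia.
Qed.

(** * Flags and their words *)

(** The length of the initial run of an antitone predicate locates the first
    index where it fails. *)
Lemma count_antitone (P : nat -> bool) m :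
    P 0 -> (forall j, P j.+1 -> P j) ->
  forall j, j <= m -> (\sum_(i < m) P i.+1 < j) = ~~ P j.
Proof.
move=> P0 PS; elim: m => [|m IH] j; first by rewrite leqn0 => /eqP->; rewrite P0.
have le : \sum_(i < m) P i.+1 <= m.
  by rewrite -[X in _ <= X]card_ord -sum1_card leq_sum // => i _; case: (P _).
rewrite big_ord_recr /=; case Pm: (P m.+1); last first.
  rewrite addn0 leq_eqVlt => /orP[/eqP->|/IH//].
  by rewrite Pm /= ltnS.
move=> jm; have Pj : P j.
  elim: (m.+1) j jm Pm => [|m' IH'] j; first by rewrite leqn0 => /eqP->.
  by rewrite leq_eqVlt => /orP[/eqP->//|h /PS]; apply: IH'.
have := IH m (leqnn m); rewrite (PS _ Pm) Pj /=; lia.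
Qed.

Section Geometry.
Variables (k : fieldType) (V : vectType k) (n : nat).
Local Notation r := (\dim {:V}).
Implicit Types (f : flag V n) (F : nat -> {vspace V}) (U L : {vspace V}).

(** The steps of a flag, indexed by all of [nat] and constant from [n] on. *)
Definition fl f (j : nat) : {vspace V} := val f (inord (minn j n)).

Lemma fl0 f : fl f 0 = 0%VS.
Proof.
have /and3P[/eqP h _ _] := valP f; rewrite /fl min0n -h; congr (val f _).
by apply/val_inj; rewrite /= inordK.
Qed.

Lemma fl_full f j : n <= j -> fl f j = fullv.
Proof.
move=> nj; have /and3P[_ /eqP h _] := valP f; rewrite /fl (minn_idPr nj) -h.
by congr (val f _); apply/val_inj; rewrite /= inordK.
Qed.

Lemma fl_fstep f (i : 'I_n) : fstep f i = fl f i.+1.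
Proof.
rewrite /fstep /fl (minn_idPl (ltn_ord i)); congr (val f _).
by apply/val_inj; rewrite /= inordK // ltnS ltn_ord.
Qed.

Lemma fl_fprev f (i : 'I_n) : fprev f i = fl f i.
Proof.
rewrite /fprev /fl (minn_idPl (ltnW (ltn_ord i))); congr (val f _).
by apply/val_inj; rewrite /= inordK // ltnS ltnW // ltn_ord.
Qed.

Lemma flS f j : (fl f j <= fl f j.+1)%VS.
Proof.
have [nj|jn] := leqP n j; first by rewrite !fl_full 1?leqW ?subvv.
have /and3P[_ _ /forallP /(_ (Ordinal jn))] := valP f.
by rewrite -/(fprev f _) -/(fstep f _) fl_fprev fl_fstep.
Qed.

Lemma chain_mono F : (forall a, (F a <= F a.+1)%VS) ->
  forall a b, a <= b -> (F a <= F b)%VS.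
Proof.
move=> h a b; elim: b => [|b IH]; first by rewrite leqn0 => /eqP->; apply: subvv.
rewrite leq_eqVlt => /orP[/eqP->|/IH ab]; first exact: subvv.
exact: subv_trans ab (h b).
Qed.

Lemma fl_mono f i j : i <= j -> (fl f i <= fl f j)%VS.
Proof. exact/chain_mono/flS. Qed.

Lemma fl_inj f f' : (forall j, j <= n -> fl f j = fl f' j) -> f = f'.
Proof.
move=> h; apply/val_inj/ffunP => i; have := h i (ltn_ord i).
by rewrite /fl (minn_idPl (ltn_ord i : i <= n)) inord_val.
Qed.

Lemma flag_of_chain (g : nat -> {vspace V}) :
    g 0 = 0%VS -> g n = fullv -> (forall j, j < n -> (g j <= g j.+1)%VS) ->
  exists f, forall j, j <= n -> fl f j = g j.
Proof.
move=> g0 gn gS.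
have fP : is_flag [ffun i : 'I_n.+1 => g i].
  rewrite /is_flag !ffunE /= g0 gn !eqxx /=; apply/forallP => i.
  by rewrite !ffunE /= gS.
exists (exist (fun g => is_true (is_flag g)) _ fP) => j jn.
by rewrite /fl /= ffunE inordK ?(minn_idPl jn) // ltnS geq_minr.
Qed.

(** A complete flag, continued by the whole space. *)
Definition full F :=
  (forall a, (F a <= F a.+1)%VS) /\ (forall a, \dim (F a) = minn a r).

Lemma full_mono F a b : full F -> a <= b -> (F a <= F b)%VS.
Proof. by case=> h _; apply: chain_mono. Qed.

Lemma full_top F a : full F -> r <= a -> F a = fullv.
Proof.
case=> _ h ra; apply/eqP; rewrite eqEdim subvf h (minn_idPr ra) /=.
exact: leqnn.
Qed.

Lemma full_dim F a : full F -> a <= r -> \dim (F a) = a.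
Proof. by case=> _ h ar; rewrite h (minn_idPl ar). Qed.

(** The letter at [b] is the number of the graded piece of [f] in which the
    line [F b.+1 / F b] lies, counted from 0. The steps [j.+1] that fail to
    capture this line are those up to that number. *)
Definition word F f b := \sum_(j < n) (F b.+1 :&: fl f j.+1 <= F b)%VS.

Lemma word_lt F f b j : full F -> b < r ->
  (word F f b < j) = ~~ (F b.+1 :&: fl f j <= F b)%VS.
Proof.
move=> Ff br; pose P i := (F b.+1 :&: fl f i <= F b)%VS.
have P0 : P 0 by rewrite /P fl0 capv0 sub0v.
have PS i i' : i <= i' -> P i' -> P i.
  by move=> h; apply: subv_trans; apply: capvS (subvv _) (fl_mono _ h).
have Pn : ~~ P n.
  rewrite /P fl_full // capvf; apply/negP => /dimvS.
  by rewrite !full_dim // ?ltnn // ltnW.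
have [jn|nj] := leqP j n.
  by rewrite -/(P j); apply: count_antitone => // i; apply: PS.
rewrite -/(P j) (negbTE (contra (PS _ _ (ltnW nj)) Pn)) /=.
apply: leq_ltn_trans nj; rewrite -[X in _ <= X]card_ord -sum1_card leq_sum //.
by move=> i _; case: (_ <= _)%VS.
Qed.

Lemma is_word_word F f : full F -> is_word r n (word F f).
Proof.
move=> Ff; split=> b br.
  by rewrite word_lt // fl_full // capvf; apply/negP => /dimvS; rewrite !full_dim // ?ltnn // ltnW.
rewrite /word (full_top Ff br) -[RHS]card_ord -sum1_card.
by apply: eq_bigr => i _; rewrite subvf.
Qed.

Lemma dim_step F U b : full F -> b < r ->
  \dim (F b.+1 :&: U) = \dim (F b :&: U) + ~~ (F b.+1 :&: U <= F b)%VS.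
Proof.
move=> Ff br; have FF : (F b <= F b.+1)%VS by case: Ff.
have [le|nle] := boolP (F b.+1 :&: U <= F b)%VS; rewrite ?addn0 ?addn1.
  congr (\dim _); apply/eqP; rewrite eqEsubv subv_cap le capvSr /=.
  exact: capvS FF (subvv _).
have /eqP E : (F b + (F b.+1 :&: U) == F b.+1)%VS.
  rewrite eqEdim subv_add FF capvSl /= full_dim // ltnNge; apply/negP => h.
  have /eqP E : (F b == F b + (F b.+1 :&: U))%VS.
    by rewrite eqEdim addvSl (full_dim Ff (ltnW br)).
  by move/negP: nle; apply; rewrite E addvSr.
have := dimv_sum_cap (F b) (F b.+1 :&: U).
rewrite E capvA (capv_idPl FF) !full_dim // 1?ltnW //; lia.
Qed.

Lemma dim_rk F f a j : full F -> a <= r -> \dim (F a :&: fl f j) = rk (word F f) a j.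
Proof.
move=> Ff; elim: a => [_|a IH ar].
  rewrite rk0; apply/eqP; rewrite dimv_eq0 -subv0.
  have /eqP -> : F 0 == 0%VS by rewrite -dimv_eq0 full_dim.
  by rewrite cap0v subvv.
by rewrite dim_step // IH 1?ltnW // rkS word_lt.
Qed.

Lemma word_unique F f w : full F -> is_word r n w ->
    (forall a j, a <= r -> j <= n -> \dim (F a :&: fl f j) = rk w a j) ->
  word F f = w.
Proof.
move=> Ff ww h; have ww' := ww; apply: (is_word_eq (is_word_word f Ff)) => //.
apply: rk_letter => a j ar; have [jn|nj] := leqP j n.
  by rewrite -h // dim_rk.
by rewrite (rk_ge_n (is_word_word f Ff) ar (ltnW nj)) (rk_ge_n ww' ar (ltnW nj)).
Qed.

Definition upd F s L a := if a == s.+1 then L else F a.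

(** The spaces that may replace [F s.+1] in a complete flag: a projective
    line. *)
Definition between F s L :=
  [&& (F s <= L)%VS, (L <= F s.+2)%VS & \dim L == s.+1].

Lemma full_upd F s L : s.+1 < r -> full F -> between F s L -> full (upd F s L).
Proof.
move=> sr Ff /and3P[h1 h2 /eqP h3]; split=> a; rewrite /upd.
  case: eqP => [->|_]; first by rewrite (_ : s.+2 == s.+1 = false) //; lia.
  rewrite eqSS; case: eqP => [->//|_]; by case: Ff.
by case: eqP => [->|_]; [rewrite h3; lia | case: Ff].
Qed.

Lemma upd_id F s L : L = F s.+1 -> upd F s L = F.
Proof. by move=> ->; apply/funext => a; rewrite /upd; case: eqP => [->|]. Qed.

Lemma updE F s L : upd F s L s.+1 = L. Proof. by rewrite /upd eqxx. Qed.

Lemma upd_neq F s L a : a != s.+1 -> upd F s L a = F a.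
Proof. by rewrite /upd => /negPf->. Qed.

Lemma between_id F s : full F -> s.+1 < r -> between F s (F s.+1).
Proof.
move=> Ff sr; rewrite /between !(full_mono Ff) // full_dim ?eqxx //; lia.
Qed.

Lemma word_off F s L f b : b != s -> b != s.+1 -> word (upd F s L) f b = word F f b.
Proof. by move=> h1 h2; rewrite /word !upd_neq. Qed.

(** The steps [s] and [s.+2] do not move, so the unordered pair of letters at
    [s] and [s.+1] is determined by them. *)
Lemma word_upd F s L f : s.+1 < r -> full F -> between F s L ->
  (dn s (word (upd F s L) f) = dn s (word F f)) /\
  (up s (word (upd F s L) f) = up s (word F f)).
Proof.
move=> sr Ff bL; have Ff' := full_upd sr Ff bL.
set w := word F f; set w' := word _ f.
have E j : (w' s < j) + (w' s.+1 < j) = (w s < j) + (w s.+1 < j).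
  have := dim_rk f j Ff' sr; rewrite upd_neq; last by lia.
  rewrite dim_rk // !rkS -/w -/w'.
  have := dim_rk f j Ff' (ltnW (ltnW sr)); rewrite upd_neq; last by lia.
  rewrite dim_rk // -/w -/w'; lia.
have := E (w s).+1; have := E (w s.+1).+1; have := E (w' s).+1.
have := E (w' s.+1).+1 => e1 e2 e3 e4.
have off b : b != s -> b != s.+1 -> w' b = w b by apply: word_off.
split; apply/funext => b; rewrite /dn /up.
  by case: eqP => [_|/eqP h1]; [lia | case: eqP => [_|/eqP h2]; [lia|apply: off]].
by case: eqP => [_|/eqP h1]; [lia | case: eqP => [_|/eqP h2]; [lia|apply: off]].
Qed.

(** If the two letters differ, say [i] is the smaller one, then the line [F
    s.+1 / F s] is the image of the part of the step [i.+1] of [f] inside [F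
    s.+2] for exactly one choice of [F s.+1], namely the sum of [F s] and that
    part. If the letters agree, nothing changes along the pencil and any
    member serves as [L0]. *)
Lemma pencil F s f : s.+1 < r -> full F -> exists L0,
  [/\ between F s L0, word (upd F s L0) f = dn s (word F f) &
     forall L, between F s L -> L <> L0 -> word (upd F s L) f = up s (word F f)].
Proof.
move=> sr Ff; set w := word F f.
have [e|ne] := eqVneq (w s) (w s.+1).
  have eud : up s w = dn s w by rewrite up_idem ?dn_idem // e.
  have allw L : between F s L -> word (upd F s L) f = dn s w.
    move=> bL; have [h1 h2] := word_upd f sr Ff bL.
    have [le|gt] := leqP (word (upd F s L) f s) (word (upd F s L) f s.+1).
      by rewrite -(dn_idem le) h1.
    by rewrite -eud -(up_idem (ltnW gt)) h2.
  exists (F s.+1); split; first exact: between_id.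
    exact/allw/between_id.
  by move=> L bL _; rewrite eud allw.
pose i := minn (w s) (w s.+1); pose M := (F s + (F s.+2 :&: fl f i.+1))%VS.
have sr0 : s < r := ltnW sr. have sr1 : s <= r := ltnW sr0.
have FF : (F s <= F s.+2)%VS by apply: full_mono => //; lia.
have dM : \dim M = s.+1.
  have := dimv_sum_cap (F s) (F s.+2 :&: fl f i.+1).
  rewrite capvA (capv_idPl FF) !dim_rk // !rkS -/w -/M full_dim //.
  rewrite /i; lia.
have bM : between F s M by rewrite /between addvSl subv_add FF capvSl dM eqxx.
exists M; split=> //.
  have [<- _] := word_upd f sr Ff bM; rewrite dn_idem //.
  have FM := full_upd sr Ff bM.
  have : word (upd F s M) f s < i.+1.
    rewrite word_lt // updE upd_neq; last by lia.
    apply/negP => h.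
    have : (F s.+2 :&: fl f i.+1 <= M :&: fl f i.+1)%VS.
      by rewrite subv_cap addvSr capvSr.
    move=> /subv_trans/(_ h) h'.
    have : M = F s by apply/addv_idPl.
    by move/(congr1 (fun U => \dim U)); rewrite dM full_dim //; lia.
  have [e1 e2] := word_upd f sr Ff bM.
  have := congr1 (fun w => w s) e1; have := congr1 (fun w => w s.+1) e1.
  by rewrite -/w /dn !eqxx (_ : s.+1 == s = false) /i; [lia|lia].
move=> L bL LM; have [e1 e2] := word_upd f sr Ff bL.
have [lt|ge] := ltnP (word (upd F s L) f s) (word (upd F s L) f s.+1); last first.
  by rewrite -e2 up_idem.
exfalso; apply: LM; have FL := full_upd sr Ff bL.
have lti : word (upd F s L) f s < i.+1.
  have := congr1 (fun w => w s) e1; have := congr1 (fun w => w s.+1) e1.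
  by rewrite -/w /dn !eqxx (_ : s.+1 == s = false) /i; [lia|lia].
move: lti; rewrite word_lt // updE upd_neq; last by lia.
move=> nle; have /and3P[h1 h2 /eqP h3] := bL.
have E : (F s + (L :&: fl f i.+1))%VS = L.
  apply/eqP; rewrite eqEdim subv_add h1 capvSl /= h3 ltnNge; apply/negP => h.
  move/negP: nle; apply.
  suff -> : F s = (F s + (L :&: fl f i.+1))%VS by apply: addvSr.
  by apply/eqP; rewrite eqEdim addvSl full_dim //.
apply/eqP; rewrite eqEdim dM h3 leqnn andbT -E.
by rewrite addvS ?subvv // capvS ?subvv.
Qed.

Lemma dim_add_line U v : v \notin U -> \dim (U + <[v]>) = (\dim U).+1.
Proof.
move=> vU; rewrite dimv_disjoint_sum.
  rewrite dim_vline (_ : v != 0%R) ?addn1 //.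
  by apply: contraNneq vU => ->; apply: mem0v.
apply/eqP; rewrite -subv0; apply/subvP => x /memv_capP[xU /vlineP[c xc]].
rewrite memv0 xc; have [->|c0] := eqVneq c 0%R; first by rewrite scale0r.
case/negP: vU; have -> : v = (c^-1 *: x)%R by rewrite xc scalerA mulVf // scale1r.
exact: memvZ.
Qed.

(** A projective line minus a point is an affine line. *)
Lemma between_line F s L0 : s.+1 < r -> full F -> between F s L0 ->
  exists line : k -> {vspace V},
  [/\ injective line, forall t, between F s (line t), forall t, line t <> L0 &
     forall L, between F s L -> L <> L0 -> exists t, L = line t].
Proof.
move=> sr Ff /and3P[h1 h2 /eqP h3].
have sr0 : s < r := ltnW sr. have sr1 : s <= r := ltnW sr0.
have FF : (F s <= F s.+2)%VS by apply: full_mono => //; lia.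
have [x xL xF] : exists2 x, x \in L0 & x \notin F s.
  by apply/subvPn/negP => /dimvS; rewrite h3 full_dim // ltnn.
have [y yF yL] : exists2 y, y \in F s.+2 & y \notin L0.
  by apply/subvPn/negP => /dimvS; rewrite h3 full_dim // ltnn.
have L0E : L0 = (F s + <[x]>)%VS.
  apply/eqP; rewrite eq_sym eqEdim h3 dim_add_line // full_dim //.
  by rewrite subv_add h1 -memvE xL leqnn.
have FE : F s.+2 = (L0 + <[y]>)%VS.
  apply/eqP; rewrite eq_sym eqEdim dim_add_line // full_dim // h3.
  by rewrite subv_add h2 -memvE yF leqnn.
pose z t := (y + t *: x)%R; pose line t := (F s + <[z t]>)%VS.
have zL t : z t \notin L0.
  by apply: contra yL => h; rewrite -(addrK (t *: x)%R y) memvB // memvZ.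
have zl t : z t \in line t by rewrite memvE addvSr.
have nl t : line t <> L0 by move=> h; move: (zl t); rewrite h; apply/negP.
have bl t : between F s (line t).
  rewrite /between addvSl subv_add FF -memvE /=.
  rewrite dim_add_line ?full_dim // //.
    by rewrite eqxx andbT memvD // memvZ // (subvP h2).
  by apply: contra (zL t); apply: subvP.
have eqd L L' : between F s L -> between F s L' -> (L <= L')%VS -> L = L'.
  move=> /and3P[_ _ /eqP d] /and3P[_ _ /eqP d'] h; apply/eqP.
  by rewrite eqEdim h d d' leqnn.
exists line; split=> //.
  move=> t t' e; apply/eqP; rewrite -subr_eq0; apply/negPn/negP => nz.
  apply: (nl t); apply/esym/eqd => //; first by rewrite /between h1 h2 h3 eqxx.
  rewrite L0E subv_add addvSl -memvE /=.
  have -> : x = ((t - t')^-1 *: (z t - z t'))%R.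
    rewrite /z opprD addrACA subrr add0r -scalerBl scalerA mulVf // scale1r //.
  by rewrite memvZ // memvB // e.
move=> L bL LL0; have [v vL vL0] : exists2 v, v \in L & v \notin L0.
  apply/subvPn/negP => h; apply: LL0; apply: eqd h => //.
  by rewrite /between h1 h2 h3 eqxx.
have /and3P[g1 g2 _] := bL.
have : v \in F s.+2 by apply: subvP vL.
rewrite FE => /memv_addP[a aL0 [_ /vlineP[c ->]] vE].
have c0 : c != 0%R.
  by apply: contraNneq vL0 => c0; rewrite vE c0 scale0r addr0.
move: aL0; rewrite L0E => /memv_addP[u uF [_ /vlineP[d ->]] aE].
exists (d / c)%R; apply/esym/eqd => //; rewrite subv_add g1 -memvE /=.
have -> : z (d / c)%R = (c^-1 *: (v - u))%R.
  rewrite vE aE addrAC (addrC u) addrK scalerDr !scalerA mulVf // scale1r addrC.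
  by rewrite /z [(d / c)%R]mulrC.
by rewrite memvZ // memvB // (subvP g1).
Qed.

(** A projective line has at least three points. *)
Lemma between_avoid F s L0 L1 : s.+1 < r -> full F -> between F s L0 ->
  exists2 L, between F s L & L <> L0 /\ L <> L1.
Proof.
move=> sr Ff b0; have [line [inj bl nl _]] := between_line sr Ff b0.
have [e|ne] := pselect (line 0%R = L1); last by exists (line 0%R).
exists (line 1%R) => //; split=> //; rewrite -e => /inj/eqP.
by rewrite oner_eq0.
Qed.

End Geometry.

(** * Galleries of complete flags *)

Section Gallery.
Variables (k : fieldType) (V : vectType k) (n : nat).
Local Notation r := (\dim {:V}).
Implicit Types (f : flag V n) (F : nat -> {vspace V}) (L : {vspace V}).

(** The flag formed by those steps of [F] whose dimensions are the numbers of
    letters of [w] below [j]. *)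
Definition cut F w f := forall j, j <= n -> fl f j = F (rk w r j).

Lemma cut_exists F w : full F -> is_word r n w -> exists f, cut F w f.
Proof.
move=> Ff ww; apply: flag_of_chain => [||j jn].
- apply/eqP; rewrite -dimv_eq0 full_dim // ?rk_le //.
  by rewrite /rk big1 // => b _; rewrite ltn0.
- by rewrite (rk_ge_n ww) // full_top.
- apply: full_mono => //; apply: leq_sum => b _.
  by lia.
Qed.

Lemma cut_up F s w f : s.+1 < r -> cut F w f -> cut F (up s w) f.
Proof. by move=> sr h j jn; rewrite rk_up_off ?h //; lia. Qed.

(** The base case of all inductions on words: for an ascending word the
    conditions at the dimensions of the steps of [f] force these steps to
    belong to [F], and then all the other ranks are those of a cut of [F]. *)
Lemma ascending_cut F w f : full F -> is_word r n w -> ascending r w ->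
  (cut F w f -> word F f = w) /\ (wle r (word F f) w -> cut F w f).
Proof.
move=> Ff ww asc; split=> [c|[h1 h2] j jn].
  apply: word_unique => // a j ar jn.
  rewrite c // (rk_asc j asc ar); have [le|lt] := leqP a (rk w r j).
    by rewrite (capv_idPl _) ?full_dim // full_mono.
  by rewrite (capv_idPr _) ?full_dim ?rk_le // full_mono // ltnW.
have dr : \dim (fl f j) = rk w r j.
  by rewrite -h2 -dim_rk // (full_top Ff (leqnn _)) capfv.
apply/eqP; rewrite eqEdim dr full_dim ?rk_le // leqnn andbT.
apply/capv_idPr/eqP; rewrite eqEdim capvSr dr /=.
rewrite dim_rk ?rk_le //; apply: leq_trans (h1 _ j (rk_le _ _ _)).
by rewrite (rk_asc j asc (rk_le w r j)) minnn.
Qed.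

(** Some member of the pencil satisfies the rank conditions of [w] if and only
    if its most special member does, which by [dn_up_adj] is the condition of
    [up s w] on [F]. *)
Lemma pencil_wle F s f w : s.+1 < r -> full F ->
  (exists2 L, between F s L & wle r (word (upd F s L) f) w) <->
  wle r (word F f) (up s w).
Proof.
move=> sr Ff; split=> [[L bL h]|h].
  apply/dn_up_adj => //; have [<- _] := word_upd f sr Ff bL.
  exact: wle_trans (dn_wle _ sr) h.
have [L0 [b0 w0 _]] := pencil f sr Ff; exists L0 => //.
by rewrite w0; apply/dn_up_adj.
Qed.

(** Walking along the pencils of a reduced expression turns the conditions of
    [w] on [f] into those of an ascending word, where [f] is a cut of the last
    complete flag of the walk. Following the same walk from the point of view
    of [f2] gives the conditions of [W]. Over a finite field, [demazure_count]
    is the same argument with numbers of points. *)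
Lemma demazure_exists (f2 : flag V n) (X : flag V n -> Prop) v w W :
    demazure r v w W -> is_word r n w ->
    (forall F f, full F -> cut F w f -> X f <-> wle r (word F f2) v) ->
  forall F, full F ->
  (exists2 f, wle r (word F f) w & X f) <-> wle r (word F f2) W.
Proof.
elim=> {w W} [w asc ww H F Ff|s w W sr hs _ IH ww H F Ff].
  split=> [[f /(proj2 (ascending_cut f Ff ww asc)) c]|le]; first by rewrite (H F f).
  have [f c] := cut_exists Ff ww; exists f; last exact/(H F f).
  by rewrite (proj1 (ascending_cut f Ff ww asc) c).
have ww0 := is_word_of_up sr hs ww.
have {}IH := IH ww0 (fun F f Ff c => H F f Ff (cut_up sr c)).
split=> [[f /pencil_wle -/(_ sr Ff)[L bL le] Xf]|/pencil_wle -/(_ sr Ff)[L bL le]].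
  apply/pencil_wle => //; exists L => //; apply/(IH _ (full_upd sr Ff bL)).
  by exists f.
have [f le' Xf] := proj2 (IH _ (full_upd sr Ff bL)) le.
by exists f => //; apply/pencil_wle => //; exists L.
Qed.

(** At each pencil of the walk the new member is chosen different from the old
    one, which is possible by [between_avoid]. As the expression is reduced
    for [w], this forces the word relative to [f] to grow at each step in the
    opposite direction, so that it is exactly [w] at the start. *)
Lemma demazure_exact (f2 : flag V n) v w W :
    demazure r v w W -> is_word r n w ->
  forall F, full F -> word F f2 = W ->
  exists F' f, [/\ full F', cut F' w f, word F' f2 = v & word F f = w].
Proof.
elim=> {w W} [w asc ww F Ff FW|s w W sr hs _ IH ww F Ff FW].
  have [f c] := cut_exists Ff ww; exists F, f; split=> //.
  by have [-> //] := ascending_cut f Ff ww asc.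
have ww0 := is_word_of_up sr hs ww.
have [L [bL LF LW]] : exists L,
    [/\ between F s L, L <> F s.+1 & word (upd F s L) f2 = W].
  have [L0 [b0 w0 w1]] := pencil f2 sr Ff.
  have [lt|ge] := ltnP (W s) (W s.+1).
    exists L0; rewrite w0 FW dn_up dn_idem 1?ltnW //; split=> // e.
    by move: w0; rewrite upd_id // FW dn_up dn_idem 1?ltnW //; apply: up_neq.
  have [L bL [n0 n1]] := between_avoid (F s.+1) sr Ff b0.
  by exists L; split=> //; rewrite w1 // FW !up_idem // up_idem.
have FL := full_upd sr Ff bL.
have [F' [f [Ff' c wv wf]]] := IH ww0 _ FL LW.
exists F', f; split=> //; first exact: cut_up.
have [L0 [b0 w0 w1]] := pencil f sr Ff.
have [_ e2] := word_upd f sr Ff bL.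
(* Relative to [f], the member [L] is the special one, so [F s.+1] is not. *)
have LL0 : L = L0.
  apply: contrapT => /(w1 _ bL); rewrite -e2 wf => /esym; exact: up_neq.
have <- : word (upd F s (F s.+1)) f = word F f by rewrite upd_id.
rewrite w1 -?e2 ?wf //; first exact: between_id.
by rewrite -LL0 => /esym.
Qed.

End Gallery.

Definition indic (P : Prop) : int := (`[< P >] : nat)%:R%R.

Lemma indic_iff P Q : (P <-> Q) -> indic P = indic Q.
Proof. by move=> h; rewrite /indic (asbool_equiv_eq h). Qed.

Lemma indic1 (P : Prop) : P -> indic P = 1%R.
Proof. by move=> h; rewrite /indic asboolT. Qed.

Lemma indic0 (P : Prop) : ~ P -> indic P = 0%R.
Proof. by move=> h; rewrite /indic asboolF. Qed.

Section Counting.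
Variables (k : finFieldType) (V : vectType k) (n : nat).
Local Notation r := (\dim {:V}).
Local Notation q := (#|k|).
Implicit Types (f : flag V n) (F : nat -> {vspace V}) (L : {vspace V}).
Local Open Scope ring_scope.

(** The first term comes from the special member of the pencil, the second one
    from the points of its complement, an affine line. *)
Lemma pencil_sum F s f (y : (nat -> nat) -> int) : (s.+1 < r)%N -> full F ->
  \sum_(L | between F s L) y (word (upd F s L) f) =
  y (dn s (word F f)) + q%:R * y (up s (word F f)).
Proof.
move=> sr Ff; have [L0 [b0 w0 w1]] := pencil f sr Ff.
rewrite (bigD1 L0) //= w0; congr (_ + _).
rewrite (eq_bigr (fun _ => y (up s (word F f)))); last first.
  by move=> L /andP[bL /eqP nL]; rewrite w1.
rewrite sumr_const mulr_natl; congr (_ *+ _).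
(* The members other than [L0] are the points of an affine line. *)
have [line [inj bl nl al]] := between_line sr Ff b0.
rewrite -(card_codom inj); apply: eq_card => L.
apply/idP/codomP => [/andP[bL /eqP nL]|[t ->]]; first exact: al.
by rewrite unfold_in bl; apply/eqP.
Qed.

(** Modulo the number of elements of the field, only the special member of
    each pencil counts; so each pencil contributes 0 or 1 according to
    [dn_up_adj]. *)
Lemma demazure_count (f2 : flag V n) (x : flag V n -> int) v w W :
    demazure r v w W -> is_word r n w ->
    (forall F f, full F -> cut F w f -> x f = indic (wle r (word F f2) v)) ->
  forall F, full F ->
  (q %| \sum_f indic (wle r (word F f) w) * x f - indic (wle r (word F f2) W))%Z.
Proof.
elim=> {w W} [w asc ww H F Ff|s w W sr hs _ IH ww H F Ff].
  have [f c] := cut_exists Ff ww; have wf := proj1 (ascending_cut f Ff ww asc) c.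
  rewrite (bigD1 f) //= big1 ?addr0 => [|f' /eqP nf].
    rewrite wf (H F f Ff c) {1}/indic asboolT ?mul1r ?subrr //; exact: wle_refl.
  rewrite {1}/indic asboolF ?mul0r // => /(proj2 (ascending_cut f' Ff ww asc)) c'.
  by apply: nf; apply: fl_inj => j jn; rewrite c ?c'.
have ww0 := is_word_of_up sr hs ww.
have {}IH F' Ff' := IH ww0 (fun F f Ff c => H F f Ff (cut_up sr c)) F' Ff'.
pose y u := indic (wle r u w).
have -> : \sum_f indic (wle r (word F f) (up s w)) * x f =
   \sum_f (\sum_(L | between F s L) y (word (upd F s L) f)) * x f
   - q%:R * \sum_f y (up s (word F f)) * x f.
  rewrite mulr_sumr -sumrB; apply: eq_bigr => f _.
  rewrite pencil_sum // mulrDl mulrA addrK; congr (_ * _).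
  by apply: indic_iff; apply: iff_sym; apply: dn_up_adj.
have -> : indic (wle r (word F f2) (up s W)) =
   \sum_(L | between F s L) indic (wle r (word (upd F s L) f2) W)
   - q%:R * indic (wle r (up s (word F f2)) W).
  rewrite (@pencil_sum F s f2 (fun u => indic (wle r u W))) // addrK.
  by apply: indic_iff; apply: iff_sym; apply: dn_up_adj.
under eq_bigr do rewrite mulr_suml.
rewrite exchange_big /=.
have e (a b c d : int) : a - b - (c - d) = (a - c) + (d - b) by ring.
rewrite e -sumrB -mulrBr; apply: rpredD; last by rewrite dvdz_mulr // natz dvdzz.
by apply: rpred_sum => L bL; apply/IH/full_upd.
Qed.

End Counting.

(** If [w] is ascending there is only one [f] to count, the cut of [F]. If [w]
    ascends at [s], then [f] has the word [up s w] relative to [F] exactly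
    when it has the word [w] relative to one member of the pencil other than
    [F s.+1], and [pencil_sum] gives a recursion with coefficients that are
    polynomial in the order of the field. *)
Lemma hall_word r n w : is_word r n w -> forall e : (nat -> nat) -> {poly int},
  exists c : (nat -> nat) -> {poly int},
  forall (k : finFieldType) (V : vectType k), \dim {:V} = r ->
  forall (f2 : flag V n) (x : flag V n -> int),
    (forall F f, full F -> cut F w f -> x f = (e (word F f2)).[#|k|%:R]%R) ->
  forall F, full F ->
  (\sum_f indic (word F f = w) * x f = (c (word F f2)).[#|k|%:R])%R.
Proof.
move: w; apply: word_ind => [w ww asc e|s w sr hs ww IH e].
  exists e => k V dV f2 x H F Ff; rewrite -dV in ww asc.
  have [f c] := cut_exists Ff ww; have wf := proj1 (ascending_cut f Ff ww asc) c.
  rewrite (bigD1 f) //= big1 ?addr0 => [|f' /eqP nf].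
    by rewrite /indic asboolT // mul1r (H F).
  rewrite /indic asboolF ?mul0r // => wf'; apply: nf; apply: fl_inj => j jn.
  by rewrite c // (proj2 (ascending_cut f' Ff ww asc)) // wf'; apply: wle_refl.
have [c Hc] := IH e.
exists (fun u => c (dn s u) + 'X * c (up s u) - c u)%R.
move=> k V dV f2 x H F Ff; rewrite -dV in sr ww.
have {}Hc F' Ff' := Hc k V dV f2 x (fun F f Ff c => H F f Ff (cut_up sr c)) F' Ff'.
rewrite !hornerE /=.
pose y u := indic (u = w).
(* Exactly one of the members other than [F s.+1] gives the word [w] if [f]
   has the word [up s w], and none otherwise. *)
have E f : indic (word F f = up s w) =
    (\sum_(L | between F s L) y (word (upd F s L) f) - y (word F f))%R.
  rewrite pencil_sum //; set u := word F f.
  have -> : y (up s u) = 0%R.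
    rewrite /y /indic asboolF // => h; have := congr1 (fun w => w s) h.
    by have := congr1 (fun w => w s.+1) h; rewrite /up !eqxx; case: eqP; lia.
  rewrite mulr0 addr0 /y.
  have [eu|nu] := pselect (u = w).
    rewrite eu dn_idem 1?ltnW // subrr /indic asboolF //.
    by move=> /esym; apply: up_neq.
  rewrite [X in (_ - X)%R]/indic (asboolF nu) subr0; apply: indic_iff; split=> [->|du].
    by rewrite dn_up dn_idem // ltnW.
  have [le|gt] := leqP (u s) (u s.+1); first by rewrite dn_idem in du.
  by rewrite -du up_dn up_idem // ltnW.
under eq_bigr do rewrite E mulrBl mulr_suml.
rewrite sumrB; congr (_ - _)%R; last exact: Hc.
rewrite exchange_big /=.
transitivity (\sum_(L | between F s L) (c (word (upd F s L) f2)).[#|k|%:R])%R.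
  by apply: eq_bigr => L bL; rewrite Hc //; apply: full_upd.
by rewrite (@pencil_sum _ _ _ F s f2 (fun u => (c u).[_]%R)).
Qed.

(** * Relative positions as matrices and as words *)

(** The matrix of dimensions of intersections that corresponds to a relative
    position; see [relpos_rk]. *)
Definition rksum n (A : 'M[nat]_n) i j :=
  \sum_(a < n | a < i) \sum_(b < n | b < j) A a b.

Lemma sum_ltS n (G : 'I_n -> nat) i (lt_in : i < n) :
  \sum_(a < n | a < i.+1) G a = \sum_(a < n | a < i) G a + G (Ordinal lt_in).
Proof.
rewrite (bigD1 (Ordinal lt_in)) //= addnC; congr (_ + _); apply: eq_bigl => a.
by rewrite -val_eqE /=; lia.
Qed.

Lemma rksum0 n (A : 'M_n) j : rksum A 0 j = 0.
Proof. by rewrite /rksum big1. Qed.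

Lemma rksumS n (A : 'M_n) i j (lt_in : i < n) :
  rksum A i.+1 j = rksum A i j + \sum_(b < n | b < j) A (Ordinal lt_in) b.
Proof. by rewrite /rksum (sum_ltS _ lt_in). Qed.

Lemma rksum_inj n (A B : 'M_n) :
  (forall i j, i <= n -> j <= n -> rksum A i j = rksum B i j) -> A = B.
Proof.
move=> h; apply/matrixP => -[a an] [b bn].
have E j : j <= n -> \sum_(b < n | b < j) A (Ordinal an) b = 
             \sum_(b < n | b < j) B (Ordinal an) b.
  by move=> jn; have := h a.+1 j an jn; rewrite !rksumS (h a j (ltnW an) jn) => /addnI.
have := E b.+1 bn; rewrite !(sum_ltS _ bn) (E b (ltnW bn)) => /addnI.
by [].
Qed.

Lemma natmx_of_inj n r : injective (@natmx_of n r).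
Proof.
move=> A B /matrixP h; apply/val_inj/matrixP => i j; apply/val_inj.
by have := h i j; rewrite !mxE.
Qed.

Lemma rksum_full n r (A : summx n r) : rksum (natmx_of A) n n = r.
Proof.
have /eqP {2}<- := valP A; rewrite /rksum; apply: eq_big => [a|a _]; first by rewrite ltn_ord.
by apply: eq_big => [b|b _]; rewrite ?ltn_ord // mxE.
Qed.

Lemma rksum_le n r (A : summx n r) i : rksum (natmx_of A) i n <= r.
Proof.
rewrite -[X in _ <= X](rksum_full A) /rksum big_mkcond [X in _ <= X]big_mkcond.
by apply: leq_sum => a _; rewrite ltn_ord; case: ifP.
Qed.

Lemma rksum_leS n (A : 'M_n) i j : i < n -> rksum A i j <= rksum A i.+1 j.
Proof. by move=> ni; rewrite (rksumS _ _ ni) leq_addr. Qed.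

(** The rank order on relative positions. Its last two conditions say that the
    types of the flags agree. *)
Definition mle n r (B A : summx n r) :=
  [/\ forall i j, i <= n -> j <= n -> rksum (natmx_of A) i j <= rksum (natmx_of B) i j,
      forall i, i <= n -> rksum (natmx_of B) i n = rksum (natmx_of A) i n &
      forall j, j <= n -> rksum (natmx_of B) n j = rksum (natmx_of A) n j].

Lemma mle_refl n r (A : summx n r) : mle A A. Proof. by []. Qed.

Lemma mle_anti n r (A B : summx n r) : mle A B -> mle B A -> A = B.
Proof.
move=> [h1 _ _] [h2 _ _]; apply/natmx_of_inj/rksum_inj => i j ni nj.
by apply/eqP; rewrite eqn_leq h1 ?h2.
Qed.

(** The largest word among those of the pairs (F, f2), where F refines the
    first flag of a pair in position [A] with second flag f2. *)
Record rep n r (A : summx n r) (w : nat -> nat) := Rep {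
  rep_word : is_word r n w;
  rep_desc : blockdesc n (fun i => rksum (natmx_of A) i n) w;
  rep_rk : forall i j, i <= n -> j <= n ->
    rk w (rksum (natmx_of A) i n) j = rksum (natmx_of A) i j
}.

Lemma rep_unique n r (A : summx n r) w w' : rep A w -> rep A w' -> w = w'.
Proof.
have half u u' : rep A u -> rep A u' -> wle r u u'.
  move=> [h1 h2 h3] [h1' h2' h3'].
  have tot j : rk u r j = rk u' r j.
    have [nj|jn] := leqP j n; last by rewrite (rk_ge_n h1) ?(rk_ge_n h1') // ltnW.
    have := h3 n j (leqnn n) nj; have := h3' n j (leqnn n) nj.
    by rewrite rksum_full => -> ->.
  apply: blockdesc_wle h2' _ tot.
  - exact: rksum0.
  - exact: rksum_full.
  - by move=> i ni; apply: rksum_leS.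
  move=> i j ni; have [nj|jn] := leqP j n; first by rewrite h3 ?h3'.
  by rewrite (rk_ge_n h1) ?(rk_ge_n h1') ?rksum_le // ltnW.
move=> h h'; apply: wle_anti (rep_word h) (rep_word h') (half _ _ h h') (half _ _ h' h).
Qed.

Section RelPos.
Variables (k : fieldType) (V : vectType k) (n : nat).
Local Notation r := (\dim {:V}).
Implicit Types (f : flag V n) (F : nat -> {vspace V}) (L : {vspace V}).

(** The truncated subtraction in [relpos] is turned into additions. *)
Lemma relpos_step f f' (a b : 'I_n) :
  relpos f f' a b + \dim (fl f a :&: fl f' b.+1) + \dim (fl f a.+1 :&: fl f' b) =
  \dim (fl f a.+1 :&: fl f' b.+1) + \dim (fl f a :&: fl f' b).
Proof.
rewrite mxE !fl_fstep !fl_fprev.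
have E U : \dim (fl f a + (fl f a.+1 :&: U)) + \dim (fl f a :&: U) =
           \dim (fl f a) + \dim (fl f a.+1 :&: U).
  by rewrite -[RHS]dimv_sum_cap capvA (capv_idPl (flS f a)).
have := E (fl f' b.+1); have := E (fl f' b).
have : \dim (fl f a + fl f a.+1 :&: fl f' b) <= \dim (fl f a + fl f a.+1 :&: fl f' b.+1).
  by rewrite dimvS // addvS ?subvv // capvS ?subvv // flS.
lia.
Qed.

Lemma relpos_rk f f' i j : i <= n -> j <= n ->
  rksum (relpos f f') i j = \dim (fl f i :&: fl f' j).
Proof.
elim: i j => [|i IH] j ni nj; first by rewrite rksum0 fl0 cap0v dimv0.
rewrite (rksumS _ _ ni) (IH j (ltnW ni) nj).
elim: j nj => [|j IHj] nj; first by rewrite big1 // !fl0 !capv0 dimv0.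
have := relpos_step f f' (Ordinal ni) (Ordinal nj); have := IHj (ltnW nj).
by rewrite (sum_ltS _ nj) /=; lia.
Qed.

Lemma pos_exists r' f f' : r = r' -> exists A : summx n r', relpos f f' = natmx_of A.
Proof.
move=> <- {r'}.
have tot : \sum_i \sum_j relpos f f' i j = r.
  have := relpos_rk f f' (leqnn n) (leqnn n).
  rewrite !fl_full // capvv => <-; rewrite /rksum; apply: eq_big => [a|a _]; rewrite ?ltn_ord //.
  by apply: eq_big => // b; rewrite ltn_ord.
have le i j : relpos f f' i j < r.+1.
  by rewrite ltnS -tot (bigD1 i) //= (bigD1 j) //= -!addnA leq_addr.
pose M : 'M['I_r.+1]_n := (\matrix_(i, j) inord (relpos f f' i j))%R.
have ME i j : M i j = relpos f f' i j :> nat by rewrite mxE inordK.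
have MP : \sum_i \sum_j M i j == r.
  by rewrite -[X in _ == X]tot; apply/eqP; do 2 (apply: eq_bigr => ? _); rewrite ME.
exists (exist (fun A : 'M['I_r.+1]_n => is_true ((\sum_i \sum_j A i j)%N == r)) M MP).
by apply/matrixP => i j; rewrite [RHS]mxE ME.
Qed.

Lemma eorbE r' (A : summx n r') f f' : eorb A (f, f') <-> relpos f f' = natmx_of A.
Proof.
split=> [[[p p'] e [g kg tr]]|e]; last first.
  exists (f, f') => //; exists \1%VF; last by move=> i; rewrite !lim1g.
  by apply/lker0P => x y; rewrite !id_lfunE.
have e1 j : fl f j = (g @: fl p j)%VS by have [] := tr (inord (minn j n)).
have e2 j : fl f' j = (g @: fl p' j)%VS by have [] := tr (inord (minn j n)).
rewrite -e; apply: rksum_inj => i j ni nj; rewrite !relpos_rk // e1 e2 -lker0_img_cap //.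
by apply: limg_dim_eq; rewrite (eqP kg) capv0.
Qed.

Definition refines F f := forall j, j <= n -> fl f j = F (\dim (fl f j)).

Lemma dim_fl_relpos r' (A : summx n r') f f' i : relpos f f' = natmx_of A -> i <= n ->
  \dim (fl f i) = rksum (natmx_of A) i n.
Proof. by move=> <- ni; rewrite relpos_rk // [fl f' n]fl_full // capvf. Qed.

Lemma dim_fl_relpos_col r' (A : summx n r') f f' j : relpos f f' = natmx_of A -> j <= n ->
  \dim (fl f' j) = rksum (natmx_of A) n j.
Proof. by move=> <- nj; rewrite relpos_rk // [fl f n]fl_full // capfv. Qed.

Lemma refines_rk F f1 f2 i j : full F -> refines F f1 -> i <= n -> j <= n ->
  rk (word F f2) (\dim (fl f1 i)) j = rksum (relpos f1 f2) i j.
Proof.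
by move=> Ff rf ni nj; rewrite -dim_rk ?dimvS ?subvf // -rf // relpos_rk.
Qed.

Lemma cut_dim F w f j : full F -> cut F w f -> j <= n -> \dim (fl f j) = rk w r j.
Proof. by move=> Ff c nj; rewrite c // full_dim // rk_le. Qed.

Lemma cut_refines F w f : full F -> cut F w f -> refines F f.
Proof. by move=> Ff c j nj; rewrite (cut_dim Ff c) // c. Qed.

Lemma full_take (X : r.-tuple V) : basis_of fullv X -> full (fun a => <<take a X>>%VS).
Proof.
move=> bX; split=> a.
  apply: sub_span => x; rewrite -(@take_takel _ a a.+1 X) //; exact: mem_take.
have : free (take a X).
  by apply: (@catl_free _ _ (drop a X)); rewrite cat_take_drop (basis_free bX).
rewrite /free => /eqP ->; rewrite size_take size_tuple /minn.
by case: ltnP.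
Qed.

Lemma full_exists : exists F, full F.
Proof. by exists (fun a => <<take a (vbasis {:V})>>%VS); apply/full_take/vbasisP. Qed.

(** Concatenate bases of complements of each step in the next one. *)
Lemma refines_exists f : exists2 F, full F & refines F f.
Proof.
pose X i := \big[cat/[::]]_(0 <= a < i) (vbasis (fl f a.+1 :\: fl f a) : seq V).
have bX i : basis_of (fl f i) (X i).
  elim: i => [|i IH]; first by rewrite /X big_geq // fl0 nil_basis.
  rewrite /X big_nat_recr //= -/(X i).
  rewrite [X in basis_of X](_ : _ = (fl f i + (fl f i.+1 :\: fl f i))%VS); last first.
    by rewrite addvC addv_diff; apply/esym/addv_idPl/flS.
  apply: cat_basis IH (vbasisP _).
  by apply/directv_addP; rewrite capvC capv_diff.
have sX i : size (X i) = \dim (fl f i).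
  by have := basis_free (bX i); rewrite /free (span_basis (bX i)) => /eqP.
have sXn : size (X n) == r by rewrite sX fl_full.
exists (fun a => <<take a (Tuple sXn)>>%VS).
  by apply: full_take; rewrite /= -(fl_full f (leqnn n)).
move=> j nj /=; rewrite -sX {2}/X (@big_cat_nat _ _ _ j) //= -/(X j).
by rewrite take_size_cat // (span_basis (bX j)).
Qed.

(** Start with an ascending word, realized by a cut, and move the complete
    flag along pencils away from their special members. *)
Lemma word_realized w : is_word r n w -> exists F f, full F /\ word F f = w.
Proof.
move: w; apply: word_ind => [w ww asc|s w sr hs ww [F [f [Ff Fw]]]].
  have [F Ff] := full_exists; have [f c] := cut_exists Ff ww.
  by exists F, f; split=> //; apply: (proj1 (ascending_cut f Ff ww asc)).
have [L0 [b0 _ w1]] := pencil f sr Ff.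
have [L bL [n0 _]] := between_avoid L0 sr Ff b0.
by exists (upd F s L), f; rewrite w1 // Fw; split=> //; apply: full_upd.
Qed.

End RelPos.

Lemma rk_nth d s a j : a <= size s -> rk (nth d s) a j = count (ltn^~ j) (take a s).
Proof.
elim: a => [|a IH] sa; first by rewrite rk0 take0.
by rewrite rkS (IH (ltnW sa)) (take_nth d sa) -cats1 count_cat /= addn0.
Qed.

Lemma count_bigcat (I : Type) (s : seq I) (P : pred I) (F : I -> seq nat) p :
  count p (\big[cat/[::]]_(a <- s | P a) F a) = \sum_(a <- s | P a) count p (F a).
Proof. by apply: (big_morph _ (count_cat p)). Qed.

(** Write the rows of [A] one after the other, each as a descending string of
    letters. *)
Lemma rep_exists n r (A : summx n r) : exists w, rep A w.
Proof.
set N := natmx_of A.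
pose row a := if insub a is Some i then
  sort geq (\big[cat/[::]]_(b < n) nseq (N i b) (b : nat)) else [::].
pose S i := \big[cat/[::]]_(0 <= a < i) row a.
have crow p i (ni : i < n) : count p (row i) = \sum_(b < n | p b) N (Ordinal ni) b.
  rewrite /row insubT /= (seq.permP (permEl (perm_sort geq _))) count_bigcat.
  rewrite [RHS]big_mkcond; apply: eq_bigr => b _; rewrite count_nseq.
  by case: (p b); rewrite ?mul1n.
have cS i j : i <= n -> count (ltn^~ j) (S i) = rksum N i j.
  elim: i => [|i IH] ni; first by rewrite /S big_geq ?rksum0.
  by rewrite /S big_nat_recr //= count_cat (IH (ltnW ni)) (rksumS _ _ ni) crow.
have sS i : i <= n -> size (S i) = rksum N i n.
  elim: i => [|i IH] ni; first by rewrite /S big_geq ?rksum0.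
  rewrite /S big_nat_recr //= size_cat (IH (ltnW ni)) (rksumS _ _ ni).
  rewrite -count_predT crow; congr (_ + _); apply: eq_bigl => b.
  by rewrite ltn_ord.
have sSn : size (S n) = r by rewrite sS // rksum_full.
have split_S i : i <= n -> exists T, S n = S i ++ T.
  by move=> ni; rewrite {1}/S (@big_cat_nat _ _ _ i) //=; eexists.
exists (nth n (S n)); split.
- split=> b br; last by rewrite nth_default ?sSn.
  have /allP : all (ltn^~ n) (S n) by rewrite all_count cS // sS.
  by apply; rewrite mem_nth ?sSn.
- move=> i b ni; rewrite -(sS i (ltnW ni)) -(sS i.+1 ni) => h1 h2.
  have [T ->] := split_S i.+1 ni.
  have E : S i.+1 = S i ++ row i by rewrite /S big_nat_recr.
  rewrite E; move: h2; rewrite E size_cat -catA => h2.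
  have so : sorted geq (row i).
    rewrite /row; case: insub => // a; apply: sort_sorted => x y.
    by rewrite /=; exact: leq_total.
  rewrite !nth_cat; do 4 (case: ifP; try lia); move=> *.
  rewrite subSn //; apply: (sortedP n so); lia.
- move=> i j ni nj; rewrite -sS // rk_nth; last first.
    by rewrite sSn sS // rksum_le.
  by have [T ->] := split_S i ni; rewrite take_size_cat // cS.
Qed.

Lemma weight_le r n w : is_word r n w -> weight r w <= r * (r * n).
Proof.
move=> [h _]; rewrite -[X in X * _]card_ord -sum_nat_const; apply: leq_sum => b _.
by apply: leq_mul; [lia | apply/ltnW/h].
Qed.

Section Link.
Variables (k : fieldType) (V : vectType k) (n : nat).
Local Notation r := (\dim {:V}).
Implicit Types (f : flag V n) (F : nat -> {vspace V}) (L : {vspace V}).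

Lemma refines_upd F f s L : refines F f -> 
  (forall j, j <= n -> \dim (fl f j) <> s.+1) -> refines (upd F s L) f.
Proof.
by move=> rf h j nj; rewrite upd_neq; [apply: rf | apply/eqP/h].
Qed.

(** As long as the word ascends somewhere inside a block, the complete flag
    can be moved along a pencil there without affecting the flag that it
    refines, and the weight of the word increases. *)
Lemma refines_maximal (A : summx n r) f1 f2 w : relpos f1 f2 = natmx_of A -> rep A w ->
  exists F, [/\ full F, refines F f1 & word F f2 = w].
Proof.
move=> e rw; have lamE i : i <= n -> \dim (fl f1 i) = rksum (natmx_of A) i n.
  exact: dim_fl_relpos e.
have [F0 Ff0 rf0] := refines_exists f1.
have [m] := ubnP (r * (r * n) - weight r (word F0 f2)).
elim: m F0 Ff0 rf0 => // m IH F Ff rf hm.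
have ww := is_word_word f2 Ff.
have [bd|] := pselect (blockdesc n (fun i => rksum (natmx_of A) i n) (word F f2)).
  exists F; split=> //; apply: rep_unique rw; split=> // i j ni nj.
  by rewrite -lamE // (refines_rk f2 Ff rf) // e.
move=> /existsNP[i /existsNP[s /not_implyP[ni /not_implyP[h1 /not_implyP[h2 /negP h3]]]]].
have sr : s.+1 < r by apply: leq_trans h2 (rksum_le _ _).
have [L0 [b0 _ w1]] := pencil f2 sr Ff.
have [L bL [n0 _]] := between_avoid L0 sr Ff b0.
have lt : word F f2 s < word F f2 s.+1 by rewrite ltnNge.
apply: (IH (upd F s L)); first exact: full_upd.
  apply: refines_upd rf _ => j nj; rewrite lamE //.
  apply: (@block_interior n (fun i => rksum (natmx_of A) i n) i) => // i' ni'.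
  exact: rksum_leS.
rewrite w1 //; have := weight_up sr lt; have := weight_le (is_word_up sr ww); lia.
Qed.

(** A step of [f1] is a step of [F], at the end of a block, and
    [blockdesc_wle] says that the other conditions of [w] are consequences. *)
Lemma mle_wle (A B : summx n r) f1 f2 w F :
    relpos f1 f2 = natmx_of B -> rep A w -> full F -> refines F f1 ->
  mle B A <->
  (forall i, i <= n -> rksum (natmx_of B) i n = rksum (natmx_of A) i n)
    /\ wle r (word F f2) w.
Proof.
move=> e [ww bd hrk] Ff rf.
have lamB i : i <= n -> \dim (fl f1 i) = rksum (natmx_of B) i n by exact: dim_fl_relpos e.
have uB i j : i <= n -> j <= n -> 
    rk (word F f2) (rksum (natmx_of B) i n) j = rksum (natmx_of B) i j.
  by move=> ni nj; rewrite -lamB // (refines_rk f2 Ff rf) // e.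
have wu := is_word_word f2 Ff.
have big u i j : is_word r n u -> n <= j -> rk u (rksum (natmx_of A) i n) j = rksum (natmx_of A) i n.
  by move=> hu nj; rewrite (rk_ge_n hu) // rksum_le.
split=> [[h1 h2 h3]|[h2 [h1 h3]]].
  split=> //; apply: (blockdesc_wle _ _ _ bd).
  - exact: rksum0.
  - exact: rksum_full.
  - by move=> i ni; apply: rksum_leS.
  - move=> i j ni; have [nj|/ltnW jn] := leqP j n; last by rewrite !big.
    by rewrite hrk // -h2 // uB // h1.
  - move=> j; have [nj|/ltnW jn] := leqP j n; last by rewrite (rk_ge_n wu) ?(rk_ge_n ww).
    have := uB n j (leqnn n) nj; have := hrk n j (leqnn n) nj.
    by rewrite !rksum_full => -> ->; rewrite h3.
split=> // [i j ni nj|j nj].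
  by rewrite -hrk // -uB // h2 // h1 // rksum_le.
by have := h3 j; rewrite -{1}(rksum_full B) -{2}(rksum_full A) uB // hrk.
Qed.

End Link.

(** * The product of two orbits *)

Lemma rep_total n r (A : summx n r) w j : rep A w -> j <= n ->
  rk w r j = rksum (natmx_of A) n j.
Proof. by move=> [_ _ h] nj; rewrite -{1}(rksum_full A) h. Qed.

Definition compat n r (a b : summx n r) :=
  forall j, j <= n -> rksum (natmx_of a) n j = rksum (natmx_of b) j n.

(** The matrix [c] is the generic product of [a] and [b]; the words are kept
    as data because all uses go through them. The last condition says that the
    type of the second flag of [a] is that of the first flag of [b]. *)
Record isprod n r (a b c : summx n r) := IsProd {
  left_word : nat -> nat; right_word : nat -> nat; prod_word : nat -> nat;
  rep_left : rep a left_word; rep_right : rep b right_word; rep_prod : rep c prod_word;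
  prod_demazure : demazure r right_word left_word prod_word;
  prod_rows : forall i, i <= n -> rksum (natmx_of c) i n = rksum (natmx_of a) i n;
  prod_compat : compat a b
}.

Section Closure.
Variables (k : fieldType) (V : vectType k) (n : nat).
Local Notation r := (\dim {:V}).
Implicit Types (f : flag V n) (F : nat -> {vspace V}) (L : {vspace V}).

Definition closorb (A : summx n r) f f' :=
  exists2 B : summx n r, relpos f f' = natmx_of B & mle B A.

Lemma closorbE (A B : summx n r) f f' : relpos f f' = natmx_of B ->
  closorb A f f' <-> mle B A.
Proof.
move=> e; split=> [[B']|h]; last by exists B.
by rewrite e => /natmx_of_inj ->.
Qed.

Lemma closorb_word (A : summx n r) f1 f2 w F : rep A w -> full F -> refines F f1 ->
  closorb A f1 f2 <->
  (forall i, i <= n -> \dim (fl f1 i) = rksum (natmx_of A) i n)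
    /\ wle r (word F f2) w.
Proof.
move=> rw Ff rf; have [B e] := pos_exists f1 f2 (erefl r).
rewrite (closorbE _ e) (mle_wle e rw Ff rf).
by split=> -[h1 h2]; split=> // i ni; rewrite -h1 // (dim_fl_relpos e).
Qed.

Lemma cut_dim_compat (a b : summx n r) wa F f i : rep a wa -> compat a b ->
  full F -> cut F wa f -> i <= n -> \dim (fl f i) = rksum (natmx_of b) i n.
Proof.
by move=> ra ab Ff c ni; rewrite (cut_dim Ff c) // (rep_total ra) // ab.
Qed.

Lemma cut_closorb (a b : summx n r) wa wb F f f2 : rep a wa -> rep b wb -> compat a b ->
  full F -> cut F wa f -> closorb b f f2 <-> wle r (word F f2) wb.
Proof.
move=> ra rb ab Ff c; rewrite (closorb_word f2 rb Ff (cut_refines Ff c)).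
by split=> [[]//|h]; split=> // i ni; apply: cut_dim_compat ra ab Ff c ni.
Qed.

(** An instance of [demazure_exists], with the conditions on [f] and [f2]
    rewritten in terms of words. *)
Lemma closorb_prod (a b : summx n r) wa wb W F f1 f2 :
    rep a wa -> rep b wb -> compat a b -> demazure r wb wa W ->
    full F -> refines F f1 ->
    (forall i, i <= n -> \dim (fl f1 i) = rksum (natmx_of a) i n) ->
  (exists2 f, closorb a f1 f & closorb b f f2) <-> wle r (word F f2) W.
Proof.
move=> ra rb ab D Ff rf rows.
have H F' f : full F' -> cut F' wa f -> closorb b f f2 <-> wle r (word F' f2) wb.
  exact: (cut_closorb f2 ra rb ab).
rewrite -(demazure_exists D (rep_word ra) H Ff).
by split=> -[f h1 h2]; exists f => //; move: h1; rewrite (closorb_word f ra Ff rf); [case|].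
Qed.

Lemma block_cut F (A : summx n r) : full F -> exists f,
  [/\ refines F f & forall i, i <= n -> \dim (fl f i) = rksum (natmx_of A) i n].
Proof.
move=> Ff; pose lam i := rksum (natmx_of A) i n.
have [||i ni|f fE] := @flag_of_chain _ _ n (fun i => F (lam i)).
- by apply/eqP; rewrite -dimv_eq0 full_dim // /lam rksum0.
- by rewrite /lam rksum_full full_top.
- by apply: full_mono => //; apply: rksum_leS.
have dE i : i <= n -> \dim (fl f i) = lam i.
  by move=> ni; rewrite fE // full_dim // rksum_le.
by exists f; split=> // i ni; rewrite dE // fE.
Qed.

Lemma relpos_realized (A : summx n r) : exists f1 f2, relpos f1 f2 = natmx_of A.
Proof.
have [w rw] := rep_exists A; have [F [f2 [Ff Fw]]] := word_realized (rep_word rw).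
have [f1 [rf rows]] := block_cut A Ff; exists f1, f2; apply: rksum_inj => i j ni nj.
by rewrite -(refines_rk f2 Ff rf) // rows // Fw (rep_rk rw).
Qed.

(** The word obtained from the 0-Hecke action is realized by some pair, whose
    relative position is [c]. That this word descends on the blocks is seen
    geometrically: by [closorb_prod] its rank conditions depend only on [f1],
    whereas an ascent inside a block could be reversed by moving [F] without
    moving [f1]. *)
Lemma isprod_exists (a b : summx n r) : compat a b -> exists c, inhabited (isprod a b c).
Proof.
move=> ab; have [wa ra] := rep_exists a; have [wb rb] := rep_exists b.
have [W wW D] := demazure_ex (rep_word rb) (rep_word ra).
have [F [f2 [Ff FW]]] := word_realized wW.
have [f1 [rf rows]] := block_cut a Ff.
have [c e] := pos_exists f1 f2 (erefl r).
have crow i : i <= n -> rksum (natmx_of c) i n = rksum (natmx_of a) i n.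
  by move=> ni; rewrite -rows // (dim_fl_relpos e).
exists c; constructor; apply: (IsProd ra rb _ D crow ab); split=> //; last first.
  by move=> i j ni nj; rewrite crow // -rows // -FW (refines_rk f2 Ff rf) // e.
move=> i s ni; rewrite (crow i (ltnW ni)) (crow i.+1 ni) => h1 h2; rewrite leqNgt; apply/negP => lt.
have sr : s.+1 < r by apply: leq_trans h2 (rksum_le _ _).
have [L0 [b0 _ w1]] := pencil f2 sr Ff.
have [L bL [n0 _]] := between_avoid L0 sr Ff b0.
have rf' : refines (upd F s L) f1.
  apply: refines_upd rf _ => j nj; rewrite rows //.
  apply: (@block_interior n (fun i => rksum (natmx_of a) i n) i) => // i' ni'.
  exact: rksum_leS.
have le : wle r (up s W) W.
  rewrite -{1}FW -(w1 L bL n0) -(closorb_prod f2 ra rb ab D (full_upd sr Ff bL) rf' rows).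
  by rewrite (closorb_prod f2 ra rb ab D Ff rf rows) FW; apply: wle_refl.
by apply: (up_neq lt); apply: wle_anti (is_word_up sr wW) wW le (wle_up _ sr).
Qed.

(** By [closorb_prod] the left side is a condition on the word of a complete
    refinement of [f1], and [closorb_word] recognizes it as that of [c]. *)
Lemma prod_closorb (a b c : summx n r) f1 f2 : isprod a b c ->
  (exists2 f, closorb a f1 f & closorb b f f2) <-> closorb c f1 f2.
Proof.
case=> wa wb W ra rb rW D crow ab; have [F Ff rf] := refines_exists f1.
rewrite (closorb_word f2 rW Ff rf); split.
  move=> h; have rows i : i <= n -> \dim (fl f1 i) = rksum (natmx_of a) i n.
    by case: h => f; rewrite (closorb_word f ra Ff rf) => -[/(_ i)].
  split; first by move=> i ni; rewrite rows // crow.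
  by rewrite -(closorb_prod f2 ra rb ab D Ff rf rows).
move=> [rows]; rewrite -(closorb_prod f2 ra rb ab D Ff rf) // => i ni.
by rewrite rows // crow.
Qed.

Lemma prod_attained (a b c : summx n r) f1 f2 : isprod a b c ->
    relpos f1 f2 = natmx_of c ->
  exists f, relpos f1 f = natmx_of a /\ relpos f f2 = natmx_of b.
Proof.
case=> wa wb W ra rb rW D crow ab e; have [F [Ff rf FW]] := refines_maximal e rW.
have [F' [f [Ff' c' wf2 wf]]] := demazure_exact D (rep_word ra) Ff FW.
exists f; split; apply: rksum_inj => i j ni nj.
  rewrite -(refines_rk f Ff rf) // wf -(rep_rk ra) //.
  by rewrite (dim_fl_relpos e) // crow.
rewrite -(refines_rk f2 Ff' (cut_refines Ff' c')) // wf2 -(rep_rk rb) //.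
by rewrite (cut_dim_compat ra ab Ff' c').
Qed.

Lemma compat_of_mid (a b : summx n r) f1 f f2 :
  closorb a f1 f -> closorb b f f2 -> compat a b.
Proof.
move=> [A e [_ _ h]] [B e' [_ h' _]] j nj.
by rewrite -h // -h' // -(dim_fl_relpos_col e) // (dim_fl_relpos e').
Qed.

End Closure.

(** * Hall polynomials and their values at zero *)
Local Open Scope ring_scope.

Lemma card_indic (T : finType) (P Q : T -> Prop) :
  #|[pred f | `[< P f >] && `[< Q f >]]|%:R = \sum_f indic (P f) * indic (Q f) :> int.
Proof.
rewrite -sum1_card natr_sum big_mkcond; apply: eq_bigr => f _.
by rewrite inE /indic; case: `[< P f >]; case: `[< Q f >].
Qed.

(** Words as the elements of a finite type, for summation. *)
Definition of_ffun n r (g : {ffun 'I_r -> 'I_n}) (b : nat) : nat :=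
  if insub b is Some i then g i else n.

Lemma is_word_of_ffun n r (g : {ffun 'I_r -> 'I_n}) : is_word r n (of_ffun g).
Proof.
split=> b br; rewrite /of_ffun; first by rewrite insubT.
by rewrite insubF // ltnNge br.
Qed.

Lemma of_ffun_inj n r : injective (@of_ffun n r).
Proof.
move=> g h e; apply/ffunP => i; apply/val_inj.
by have := congr1 (fun w => w (val i)) e; rewrite /of_ffun valK.
Qed.

Lemma of_ffun_surj n r w : is_word r n w -> exists g, w = @of_ffun n r g.
Proof.
move=> [h h']; exists [ffun i : 'I_r => Ordinal (h i (ltn_ord i))].
apply/funext => b; rewrite /of_ffun; case: insubP => [i _ <-|].
  by rewrite ffunE.
by rewrite -leqNgt => /h'.
Qed.

(** The words of the complete refinements of the first flag of a pair in
    position [A]. *)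
Definition blocks n r (A : summx n r) (w : nat -> nat) :=
  forall i j, (i <= n)%N -> (j <= n)%N ->
    rk w (rksum (natmx_of A) i n) j = rksum (natmx_of A) i j.

Lemma relpos_blocks (k : fieldType) (V : vectType k) n (A : summx n (\dim {:V}))
    (f1 f2 : flag V n) F :
    full F -> refines F f1 ->
    (forall i, (i <= n)%N -> \dim (fl f1 i) = rksum (natmx_of A) i n) ->
  relpos f1 f2 = natmx_of A <-> blocks A (word F f2).
Proof.
move=> Ff rf rows; split=> [e i j ni nj|h].
  by rewrite -rows // (refines_rk f2 Ff rf) // e.
by apply: rksum_inj => i j ni nj; rewrite -(refines_rk f2 Ff rf) // rows // h.
Qed.

(** Refine [f1] to a complete flag whose word relative to [f2] is the
    canonical one of [C], and split the flags [f] according to their word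
    relative to it; [hall_word] counts each part. *)
Theorem hall_exists n r (A A' C : summx n r) : exists g, hall_spec A A' C g.
Proof.
have [wC rC] := rep_exists C.
pose e w u := (indic (forall i j, (i <= n)%N -> (j <= n)%N ->
  rk u (rk w r i) j = rksum (natmx_of A') i j))%:P : {poly int}.
have /choice[c Hc] : forall g : {ffun 'I_r -> 'I_n}, exists c, 
  forall (k : finFieldType) (V : vectType k), \dim {:V} = r ->
  forall (f2 : flag V n) (x : flag V n -> int),
    (forall F f, full F -> cut F (of_ffun g) f -> x f = (e (of_ffun g) (word F f2)).[#|k|%:R]) ->
  forall F, full F ->
  \sum_f indic (word F f = of_ffun g) * x f = (c (word F f2)).[#|k|%:R].
  by move=> g; apply: hall_word (is_word_of_ffun g) (e (of_ffun g)).
pose rows := forall i, (i <= n)%N -> rksum (natmx_of C) i n = rksum (natmx_of A) i n.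
exists ((indic rows)%:P * \sum_g (indic (blocks A (of_ffun g)))%:P * c g wC).
move=> k V dV f1 f2 /eorbE eC; subst r.
have [F [Ff rf FwC]] := refines_maximal eC rC.
have dimC i : (i <= n)%N -> \dim (fl f1 i) = rksum (natmx_of C) i n.
  exact: dim_fl_relpos eC.
have E f : indic (eorb A (f1, f)) =
    indic rows * \sum_(g : {ffun 'I_(\dim {:V}) -> 'I_n}) indic (blocks A (of_ffun g)) * indic (word F f = of_ffun g).
  have [rw|nrw] := pselect rows; last first.
    rewrite (indic0 nrw) mul0r indic0 // => /eorbE eA; apply: nrw => i ni.
    by rewrite -dimC // (dim_fl_relpos eA).
  have rows1 i : (i <= n)%N -> \dim (fl f1 i) = rksum (natmx_of A) i n.
    by move=> ni; rewrite dimC // rw.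
  rewrite (indic1 rw) mul1r (indic_iff (eorbE _ _ _)) (indic_iff (relpos_blocks f Ff rf rows1)).
  have [g0 g0E] := of_ffun_surj (is_word_word f Ff).
  rewrite (bigD1 g0) //= (indic1 g0E) mulr1 -g0E big1 ?addr0 // => g /eqP ng.
  by rewrite (@indic0 (word _ _ = _)) ?mulr0 // g0E => /of_ffun_inj /esym.
rewrite card_indic hornerM hornerC horner_sum.
under [RHS]eq_bigr => f _ do rewrite E -mulrA mulr_suml.
rewrite -mulr_sumr exchange_big /=; congr (_ * _); apply: eq_bigr => g _.
rewrite hornerM hornerC -FwC -(Hc g k V erefl f2 (fun f => indic (eorb A' (f, f2)))) //.
  by rewrite mulr_sumr; apply: eq_bigr => f _; rewrite mulrA.
move=> F' f Ff' c'; rewrite hornerC; apply: indic_iff; rewrite eorbE.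
have rf' := cut_refines Ff' c'.
split=> [e' i j ni nj|h].
  by rewrite -(cut_dim Ff' c') // (refines_rk f2 Ff' rf') // e'.
apply: rksum_inj => i j ni nj.
by rewrite -(refines_rk f2 Ff' rf') // (cut_dim Ff' c') // h.
Qed.

(** By [demazure_count] the number of middle flags in positions at most [a]
    and at most [b] is 0 or 1 modulo the order of the field, if [f1] has the
    type of [a]; otherwise there are none. *)
Lemma closorb_count (k : finFieldType) (V : vectType k) n (a b c : summx n (\dim {:V}))
    (f1 f2 : flag V n) : isprod a b c ->
  (#|k| %| \sum_f indic (closorb a f1 f) * indic (closorb b f f2) - indic (closorb c f1 f2))%Z.
Proof.
move=> [wa wb W ra rb rW D crow ab]; have [F Ff rf] := refines_exists f1.
have [rows|nrows] := pselect (forall i, (i <= n)%N -> \dim (fl f1 i) = rksum (natmx_of a) i n).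
  have cE : closorb c f1 f2 <-> wle (\dim {:V}) (word F f2) W.
    rewrite (closorb_word f2 rW Ff rf); split=> [[]//|h]; split=> // i ni.
    by rewrite rows // crow.
  have aE f : closorb a f1 f <-> wle (\dim {:V}) (word F f) wa.
    by rewrite (closorb_word f ra Ff rf); split=> [[]|].
  rewrite (indic_iff cE); under eq_bigr do rewrite (indic_iff (aE _)).
  apply: (demazure_count D (rep_word ra) _ Ff) => F' f Ff' c'.
  exact/indic_iff/(cut_closorb f2 ra rb ab Ff' c').
rewrite indic0; last first.
  rewrite (closorb_word f2 rW Ff rf) => -[h _]; apply: nrows => i ni.
  by rewrite h // crow.
rewrite big1 ?subrr // => f _; rewrite indic0 ?mul0r //.
by rewrite (closorb_word f ra Ff rf) => -[h _]; apply: nrows.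
Qed.

Lemma hall_polyP n r (A A' C : summx n r) : hall_spec A A' C (hall_poly A A' C).
Proof. by have [g hg] := hall_exists A A' C; exact: xgetPex (ex_intro _ g hg). Qed.

Lemma dvdz_horner0 (p : {poly int}) (x : int) : (x %| p.[x] - p.[0])%Z.
Proof.
have /factor_theorem[h hE] : root (p - p.[0]%:P) 0 by rewrite /root !hornerE subrr.
have -> : p.[x] - p.[0] = (p - p.[0]%:P).[x] by rewrite !hornerE.
by rewrite hE !hornerE dvdz_mull.
Qed.

Lemma eq_of_dvdz_primes (m : int) : (forall p, prime p -> (p%:Z %| m)%Z) -> m = 0.
Proof.
move=> h; have [p lt pp] := prime_above `|m|%N; have := h p pp.
rewrite dvdzE /= => d; apply/eqP; rewrite -absz_eq0; apply: contraTT d => nz.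
by rewrite gtnNdvd // lt0n.
Qed.

Definition zero_sum n r (a b c : summx n r) : int :=
  \sum_a' \sum_b' indic (mle a' a) * indic (mle b' b) * (hall_poly a' b' c).[0].

Lemma indic_closorb (k : fieldType) (V : vectType k) n r (A : summx n r)
    (f1 f2 : flag V n) : \dim {:V} = r ->
  indic (exists2 B : summx n r, relpos f1 f2 = natmx_of B & mle B A) =
  \sum_B indic (mle B A) * indic (eorb B (f1, f2)).
Proof.
move=> dV; have [B0 e0] := pos_exists f1 f2 dV.
rewrite (bigD1 B0) //= big1 ?addr0 => [|B /eqP nB].
  rewrite (@indic1 (eorb _ _)) ?eorbE // mulr1; apply: indic_iff.
  by split=> [[B]|h]; [rewrite e0 => /natmx_of_inj-> | exists B0].
rewrite (@indic0 (eorb _ _)) ?mulr0 // => /eorbE; rewrite e0 => /natmx_of_inj h.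
by apply: nB.
Qed.

(** The values of an integral polynomial at 0 and at a prime [p] are congruent
    modulo [p], and the value at [p] is a number of points over the prime
    field. A congruence modulo all primes is an equality. *)
Lemma zero_sum_eq n r (a b c : summx n r) (eps : int) :
    (forall (k : finFieldType) (V : vectType k) (f1 f2 : flag V n), \dim {:V} = r ->
      relpos f1 f2 = natmx_of c ->
      (#|k| %| \sum_f (\sum_B indic (mle B a) * indic (eorb B (f1, f))) *
                       (\sum_B indic (mle B b) * indic (eorb B (f, f2))) - eps)%Z) ->
  zero_sum a b c = eps.
Proof.
move=> H; apply/eqP; rewrite -subr_eq0; apply/eqP/eq_of_dvdz_primes => p pp.
pose V : vectType 'F_p := 'rV['F_p]_r.
have dV : \dim {:V} = r by rewrite dimvf /dim /= mul1n.
pose g : {poly int} := \sum_a' \sum_b' (indic (mle a' a) * indic (mle b' b))%:P * hall_poly a' b' c.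
have g0 : g.[0] = zero_sum a b c.
  rewrite /g horner_sum; apply: eq_bigr => a' _; rewrite horner_sum.
  by apply: eq_bigr => b' _; rewrite hornerM hornerC.
have [f1 [f2 e]] : exists f1 f2 : flag V n, relpos f1 f2 = natmx_of c.
  by clearbody V; subst r; apply: relpos_realized.
(* Compare the number of points over the prime field with the value at 0. *)
have := H _ V f1 f2 dV e; rewrite card_Fp //.
rewrite (_ : \sum_f _ = g.[p%:R]); last first.
  rewrite /g horner_sum; under [RHS]eq_bigr do rewrite horner_sum.
  transitivity (\sum_a' \sum_b' \sum_f (indic (mle a' a) * indic (eorb a' (f1, f))) *
                       (indic (mle b' b) * indic (eorb b' (f, f2)))).
    under eq_bigr do rewrite mulr_suml; rewrite exchange_big /=.
    apply: eq_bigr => a' _; under eq_bigr do rewrite mulr_sumr.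
    by rewrite exchange_big.
  apply: eq_bigr => a' _; apply: eq_bigr => b' _; rewrite hornerM hornerC.
  have hp : hall_spec a' b' c (hall_poly a' b' c) by apply: hall_polyP.
  have := hp _ V dV f1 f2; rewrite card_Fp // => ->; last exact/eorbE.
  by rewrite card_indic mulr_sumr; apply: eq_bigr => f _; rewrite mulrACA.
move=> d1; have d2 := dvdz_horner0 g p%:R; rewrite natz in d1 d2.
have -> : zero_sum a b c - eps = (g.[p%:Z] - eps) - (g.[p%:Z] - g.[0]).
  by rewrite g0; ring.
exact: rpredB.
Qed.

Lemma zero_sum_prod n r (a b c d : summx n r) : isprod a b d ->
  zero_sum a b c = indic (mle c d).
Proof.
move=> pd; apply: zero_sum_eq => k V f1 f2 dV e; subst r.
rewrite -(indic_iff (closorbE d e)).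
by under eq_bigr do rewrite -!indic_closorb //; apply: closorb_count.
Qed.

Lemma zero_sum_incompat n r (a b c : summx n r) : ~ compat a b -> zero_sum a b c = 0.
Proof.
move=> nab; apply: zero_sum_eq => k V f1 f2 dV e; subst r.
rewrite big1 ?subrr // => f _; rewrite -!indic_closorb // -!/(closorb _ _ _).
have [h1|h1] := pselect (closorb a f1 f); last by rewrite (indic0 h1) mul0r.
have [h2|h2] := pselect (closorb b f f2); last by rewrite (indic0 h2) mulr0.
by case: nab; apply: compat_of_mid h1 h2.
Qed.

(** * Pluecker coordinates *)

Lemma unit_minor (k : fieldType) m N (A : 'M[k]_(m, N)) :
  exists f (g : 'I_(\rank A) -> 'I_N), mxsub f g A \in unitmx.
Proof.
set B := rowsub (maxrankfun A) A.
have rfB : row_full B^T by rewrite /row_full mxrank_tr; apply: maxrowsub_free.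
exists (maxrankfun A), (fullrankfun rfB); rewrite -unitmx_tr.
have := fullrowsub_unit rfB; congr (_ \in unitmx).
by apply/matrixP => i j; rewrite !mxE.
Qed.

Lemma minor_rank (k : fieldType) m N d (A : 'M[k]_(m, N)) (f : 'I_d -> 'I_m) g :
  \det (mxsub f g A) != 0 -> (d <= \rank A)%N.
Proof.
rewrite -unitfE -unitmxE -row_free_unit => /eqP {1}<-.
have -> : mxsub f g A = rowsub f (1%:M : 'M_m) *m A *m (rowsub g (1%:M : 'M_N))^T.
  rewrite -rowsubE; apply/matrixP => i j; rewrite !mxE (bigD1 (g j)) //= !mxE eqxx mulr1.
  by rewrite big1 ?addr0 // => l nl; rewrite !mxE eq_sym (negPf nl) mulr0.
exact: leq_trans (mxrankM_maxl _ _) (mxrankM_maxr _ _).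
Qed.

Import VectorInternalTheory passmx.

Section Coordinates.
Variables (k : fieldType) (V : vectType k).
Local Notation N := (\dim {:V}).
Local Notation e := (vbasis {:V}).

Definition coord_rows m (Z : 'I_m -> V) : 'M[k]_(m, N) := \matrix_(a, c) coord e c (Z a).

Lemma rank_coord_rows m (Z : m.-tuple V) : \rank (coord_rows (tnth Z)) = \dim <<Z>>%VS.
Proof.
pose Q : 'M[k]_(dim V, N) := lin1_mx (rVof e \o r2v).
pose Q' : 'M[k]_(N, dim V) := lin1_mx (v2r \o vecof e).
have fQ : row_free Q.
  apply/row_freeP; exists Q'; apply/row_matrixP => i.
  rewrite row_mul row1 [row i Q]rowE /Q /Q' !mul_rV_lin1 /=.
  by rewrite rVofK ?vbasisP // r2vK.
have -> : coord_rows (tnth Z) = b2mx Z *m Q.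
  apply/row_matrixP => i; rewrite row_mul /b2mx /Q rowK mul_rV_lin1 /= v2rK.
  by apply/rowP => c; rewrite !mxE.
rewrite mxrankMfree // (_ : span Z = mx2vs (b2mx Z)); first by rewrite [RHS]mx2vsK.
by rewrite unlock tvalK; case: _ / (esym _).
Qed.

Definition minor d (Z : 'I_d -> V) (phi : 'I_d -> 'I_N) : k := \det (mxsub id phi (coord_rows Z)).

Definition plc (Z : seq V) (T : {set 'I_N}) : k :=
  if #|T| == size Z then
    \det (\matrix_(a < #|T|, b < #|T|) coord e (enum_val b) Z`_a)
  else 0.

Lemma plucker_plc U T : plucker U T = plc (vbasis U) T.
Proof. by rewrite /plucker /plc size_tuple. Qed.

(** Another basis changes all Pluecker coordinates by the same factor, a
    determinant. *)
Lemma plucker_basis (U : {vspace V}) (Y : seq V) : basis_of U Y ->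
  exists2 c, c != 0 & forall T, plucker U T = c * plc Y T.
Proof.
move=> bY; have sY : size Y = \dim U.
  by have := basis_free bY; rewrite /free (span_basis bY) => /eqP.
pose Yt : (\dim U).-tuple V := Tuple (introT eqP sY).
pose K : 'M_(\dim U) := \matrix_(a, b) coord Yt b (vbasis U)`_a.
have KE (a : 'I_(\dim U)) : (vbasis U)`_a = \sum_b K a b *: Y`_b.
  rewrite [LHS](@coord_span _ _ _ Yt); last first.
    by rewrite (span_basis bY) vbasis_mem // mem_nth // size_tuple.
  by apply: eq_bigr => b _; rewrite mxE.
exists (\det K).
  apply/negP => /det0P[v nz vK]; case/negP: nz; apply/eqP/rowP => a; rewrite mxE.
  have /freeP := basis_free (vbasisP U); apply.
  under eq_bigr do rewrite KE scaler_sumr.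
  rewrite exchange_big /= big1 // => b _.
  under eq_bigr do rewrite scalerA; rewrite -scaler_suml.
  have := congr1 (fun u : 'rV_ _ => u 0 b) vK; rewrite !mxE => ->.
  by rewrite scale0r.
move=> T; rewrite plucker_plc /plc size_tuple sY; case: eqP => [eT|_]; last by rewrite mulr0.
have {}eT : \dim U = #|T| by [].
have gen m (phi : 'I_m -> 'I_N) : \dim U = m ->
    \det (\matrix_(a < m, b < m) coord e (phi b) (vbasis U)`_a) =
    \det K * \det (\matrix_(a < m, b < m) coord e (phi b) Y`_a).
  move=> em; case: _ / em in phi *; rewrite -det_mulmx; congr (\det _).
  apply/matrixP => a b; rewrite !mxE KE linear_sum /=; apply: eq_bigr => l _.
  by rewrite linearZ /= mxE.
exact: gen.
Qed.

(** Sorting the columns costs a sign and a repeated column makes the minor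
    vanish; hence a factor that depends on the list of columns only. *)
Lemma minor_plucker d (phi : 'I_d -> 'I_N) : exists minor_sign : k,
  forall (U : {vspace V}), \dim U = d ->
  minor (fun a : 'I_d => (vbasis U)`_a) phi = minor_sign * plucker U [set phi b | b : 'I_d].
Proof.
have [inj|ninj] := pselect (injective phi); last first.
  have [i [j [ij ne]]] : exists i j, phi i = phi j /\ i != j.
    apply: contrapT => h; apply: ninj => i j ij; apply/eqP/negPn/negP => ne.
    by apply: h; exists i, j.
  exists 0 => U _; rewrite mul0r /minor -det_tr; apply: (determinant_alternate ne) => l.
  by rewrite !mxE ij.
set T := [set phi b | b : 'I_d].
have cT : #|T| = d by rewrite card_imset // card_ord.
have phiT b : phi b \in T by apply: imset_f.
pose sg (x : 'I_#|T|) := enum_rank_in (phiT (cast_ord cT x)) (phi (cast_ord cT x)).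
have sgE x : enum_val (sg x) = phi (cast_ord cT x) by rewrite enum_rankK_in.
have sginj : injective sg.
  by move=> x y /(congr1 enum_val); rewrite !sgE => /inj /cast_ord_inj.
exists ((-1) ^+ (perm sginj)) => U dU.
have tU : #|T| == \dim U by rewrite cT dU.
rewrite /plucker tU /minor.
have gen m (c : d = m) : \det (mxsub id phi (coord_rows (fun a : 'I_d => (vbasis U)`_a))) =
   \det (\matrix_(a < m, b < m) coord e (phi (cast_ord (esym c) b)) (vbasis U)`_a).
  case: _ / c; congr (\det _); apply/matrixP => a b; rewrite !mxE.
  by congr (coord _ (phi _) _); apply/val_inj.
rewrite (gen _ (esym cT)) -det_perm -[X in _ * X]det_tr -det_mulmx -row_permE -det_tr.
congr (\det _); apply/matrixP => a b; rewrite !mxE permE sgE.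
by congr (coord _ (phi _) _); apply/val_inj.
Qed.

End Coordinates.

(** * The open orbit *)

Section MultiHomogeneous.
Variables (k : fieldType) (V : vectType k) (n : nat).
Local Notation N := (\dim {:V}).
Local Notation nv := #|pvar V n|.
Implicit Types (P Q : {mpoly k[nv]}) (d : Defs.pblock n -> nat).
Local Open Scope ring_scope.

(** Multihomogeneity with the multidegree made explicit; in this form it is
    stable under sums. *)
Definition mhom d P := forall m, m \in msupp P -> forall b,
  (\sum_(T : {set 'I_N}) m (enum_rank ((b, T) : pvar V n)))%N = d b.

Lemma mhom_multi d P : mhom d P -> multihomogeneous P.
Proof. by move=> h b; exists (d b) => m mP; apply: h. Qed.

Lemma mhom0 d : mhom d 0.
Proof. by move=> m; rewrite msupp0. Qed.

Lemma mhomD d P Q : mhom d P -> mhom d Q -> mhom d (P + Q).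
Proof.
by move=> hP hQ m /msuppD_le; rewrite mem_cat => /orP[/hP|/hQ].
Qed.

Lemma mhomN d P : mhom d P -> mhom d (- P).
Proof. by move=> hP m; rewrite (perm_mem (msuppN _)) => /hP. Qed.

Lemma mhomM d d' P Q : mhom d P -> mhom d' Q -> mhom (fun b => d b + d' b)%N (P * Q).
Proof.
move=> hP hQ m /msuppM_le/allpairsP[[m1 m2] /= [h1 h2 ->]] b.
by rewrite -(hP _ h1) -(hQ _ h2) -big_split; apply: eq_bigr => T _; rewrite mnmDE.
Qed.

Lemma mhomC (c : k) : mhom (fun=> 0%N) c%:MP.
Proof.
move=> m; rewrite msuppC; case: (c == 0) => //; rewrite inE => /eqP-> b.
by rewrite big1 // => T _; rewrite mnm0E.
Qed.

Lemma mhomZ d c P : mhom d P -> mhom d (c *: P).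
Proof. by move=> hP m /msuppZ_le; apply: hP. Qed.

Lemma mhomX (b : Defs.pblock n) T : mhom (fun b' => b' == b : nat) 'X_(enum_rank ((b, T) : pvar V n)).
Proof.
move=> m; rewrite msuppX inE => /eqP-> b'.
under eq_bigr do rewrite mnm1E (inj_eq enum_rank_inj) xpair_eqE eq_sym.
have [_|_] := eqVneq b' b; last by rewrite big1.
rewrite (bigD1 T) //= eqxx big1 ?addn0 // => T' /negPf; rewrite eq_sym => ->.
by [].
Qed.

Lemma mhom_sum d (I : Type) (s : seq I) (R : pred I) (F : I -> {mpoly k[nv]}) :
  (forall i, R i -> mhom d (F i)) -> mhom d (\sum_(i <- s | R i) F i).
Proof. by move=> h; elim/big_ind: _ => //; [apply: mhom0 | apply: mhomD]. Qed.

Lemma mhom_prod (I : Type) (s : seq I) (d : I -> Defs.pblock n -> nat) (F : I -> {mpoly k[nv]}) :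
  (forall i, mhom (d i) (F i)) ->
  mhom (fun b => \sum_(i <- s) d i b)%N (\prod_(i <- s) F i).
Proof.
move=> h; elim: s => [|i s IH].
  rewrite big_nil => m hm b; rewrite big_nil; exact: (mhomC (c := 1)).
rewrite big_cons => m hm b; rewrite big_cons; exact: (mhomM (h i) IH).
Qed.

Lemma mhom_det m (M : 'M[{mpoly k[nv]}]_m) (d : 'I_m -> Defs.pblock n -> nat) :
  (forall a c, mhom (d a) (M a c)) -> mhom (fun b => \sum_a d a b)%N (\det M).
Proof.
move=> h; apply: mhom_sum => s _.
have hp : mhom (fun b => \sum_a d a b)%N (\prod_a M a (s a)) by apply: mhom_prod.
case: (odd_perm s); first by rewrite expr1 mulN1r; apply: mhomN.
by rewrite expr0 mul1r.
Qed.

Definition pval (p : flag V n * flag V n) P : k := P.@[fun v => pcoord p (enum_val v)].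

Definition pspace (p : flag V n * flag V n) (b : Defs.pblock n) : {vspace V} :=
  val (if b.1 then p.1 else p.2) b.2.

Lemma pvalX p b T : pval p 'X_(enum_rank ((b, T) : pvar V n)) = plucker (pspace p b) T.
Proof. by rewrite /pval mevalXU enum_rankK; case: b. Qed.

Definition minor_sign (d : nat) (phi : 'I_d -> 'I_N) : k := projT1 (cid (minor_plucker phi)).

Definition bmx (d : nat) (U : {vspace V}) : 'M[k]_(d, N) := coord_rows (fun a : 'I_d => (vbasis U)`_a).

Definition setcol (d : nat) (phi : 'I_d -> 'I_N) a0 c b := if b == a0 then c else phi b.

(** Linear forms in the Pluecker coordinates of a subspace whose values are
    the coordinates of vectors that lie in it, and that span it if the minor
    on the columns [phi] is nonzero. They are the rows of Cramer's rule: see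
    [cramer_rows_val]. *)
Definition cramer_rows (d : nat) b (phi : 'I_d -> 'I_N) : 'M[{mpoly k[nv]}]_(d, N) :=
  \matrix_(a, c) (minor_sign (setcol phi a c) *:
    'X_(enum_rank ((b, [set setcol phi a c x | x : 'I_d]) : pvar V n))).

Lemma cramer_rows_mhom (d : nat) b (phi : 'I_d -> 'I_N) a c : mhom (fun b' => b' == b : nat) (cramer_rows b phi a c).
Proof. by rewrite mxE; apply/mhomZ/mhomX. Qed.

(** Expand the minor along the column that was replaced. *)
Lemma cramer_rows_val (d : nat) b (phi : 'I_d -> 'I_N) p : \dim (pspace p b) = d ->
  map_mx (pval p) (cramer_rows b phi) =
  \adj (mxsub id phi (bmx d (pspace p b))) *m bmx d (pspace p b).
Proof.
move=> dU; apply/matrixP => a c; rewrite !mxE /pval mevalZ -/(pval p _) pvalX.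
rewrite /minor_sign; case: cid => e /= <- //.
rewrite /minor (expand_det_col _ a); apply: eq_bigr => i _.
rewrite mulrC !mxE /setcol eqxx; congr (_ * _).
rewrite /cofactor; congr (_ * \det _); apply/matrixP => x y; rewrite !mxE.
by rewrite eq_sym (negPf (neq_lift _ _)).
Qed.

Lemma rank_bmx (d : nat) (U : {vspace V}) : \dim U = d -> \rank (bmx d U) = d.
Proof.
move=> <-; rewrite -[RHS](congr1 (fun U => \dim U) (span_basis (vbasisP U))) -rank_coord_rows.
by congr (\rank (coord_rows _)); apply/funext => a; rewrite (tnth_nth 0).
Qed.

Lemma rank_bmx_add (d d' : nat) (U U' : {vspace V}) : \dim U = d -> \dim U' = d' ->
  \rank (col_mx (bmx d U) (bmx d' U')) = \dim (U + U').
Proof.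
move=> <- <-; have -> : (U + U')%VS = <<[tuple of vbasis U ++ vbasis U']>>%VS.
  by rewrite /= span_cat !(span_basis (vbasisP _)).
rewrite -rank_coord_rows; congr (\rank _); apply/matrixP => i c.
rewrite -[i]splitK; case: (split i) => j /=.
  rewrite col_mxEu !mxE (tnth_nth 0) /= nth_cat size_tuple ltn_ord.
  by [].
rewrite col_mxEd !mxE (tnth_nth 0) /= nth_cat size_tuple.
by rewrite ltnNge leq_addr /= addKn.
Qed.

Lemma unit_columns (d : nat) (U : {vspace V}) : \dim U = d ->
  exists phi, mxsub id phi (bmx d U) \in unitmx.
Proof.
move=> dU; have rf : row_full (bmx d U)^T by rewrite /row_full mxrank_tr rank_bmx.
exists (fullrankfun rf); rewrite -unitmx_tr; have := fullrowsub_unit rf.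
by congr (_ \in unitmx); apply/matrixP => i j; rewrite !mxE.
Qed.

Lemma pval_det m p (M : 'M[{mpoly k[nv]}]_m) : pval p (\det M) = \det (map_mx (pval p) M).
Proof. by rewrite /pval -det_map_mx. Qed.

Lemma adj_full (d : nat) (A : 'M[k]_d) : A \in unitmx -> row_full (\adj A).
Proof.
move=> uA; rewrite row_full_unit; move: uA; rewrite !unitmxE !unitfE => nz.
have := congr1 determinant (mul_mx_adj A); rewrite det_mulmx det_scalar => e.
by apply: contraNneq nz => e0; move: e; rewrite e0 mulr0 => /esym/eqP; rewrite expf_eq0 => /andP[].
Qed.

(** A large intersection is a small sum. Stack the Cramer rows of the two
    steps; the values of the result at [q] span a subspace of the sum of the
    two steps, and at [p] they span all of it. So a maximal nonzero minor at
    [p] vanishes at [q]. *)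
Lemma separating_poly p (b b' : Defs.pblock n) : exists P d, [/\ mhom d P, pval p P != 0 &
  forall q, \dim (pspace q b) = \dim (pspace p b) ->
    \dim (pspace q b') = \dim (pspace p b') ->
    (\dim (pspace p b :&: pspace p b') < \dim (pspace q b :&: pspace q b'))%N ->
  pval q P = 0].
Proof.
set d := \dim (pspace p b); set d' := \dim (pspace p b').
have [phi uphi] := unit_columns (erefl d); have [phi' uphi'] := unit_columns (erefl d').
pose A := col_mx (cramer_rows b phi) (cramer_rows b' phi').
have AE q : \dim (pspace q b) = d -> \dim (pspace q b') = d' -> map_mx (pval q) A =
  col_mx (\adj (mxsub id phi (bmx d (pspace q b))) *m bmx d (pspace q b))
         (\adj (mxsub id phi' (bmx d' (pspace q b'))) *m bmx d' (pspace q b')).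
  by move=> e e'; rewrite map_col_mx !cramer_rows_val.
have [f [g ufg]] := unit_minor (map_mx (pval p) A).
have rkp : \rank (map_mx (pval p) A) = \dim (pspace p b + pspace p b').
  rewrite AE // -(rank_bmx_add (erefl d) (erefl d')) -!addsmxE.
  by rewrite (adds_eqmx (eqmxMfull _ (adj_full uphi)) (eqmxMfull _ (adj_full uphi'))).
pose dl (l : 'I_(d + d')) : Defs.pblock n := if split l is inl _ then b else b'.
exists (\det (mxsub f g A)), (fun b0 : Defs.pblock n => \sum_a (b0 == dl (f a) : nat))%N; split.
- apply: mhom_det => a c; rewrite mxE /A /dl mxE.
  by case: (split (f a)) => j; apply: cramer_rows_mhom.
- by rewrite pval_det map_mxsub -unitfE -unitmxE.
move=> q e e' lt; apply/eqP/negPn/negP; rewrite pval_det map_mxsub => /minor_rank.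
rewrite rkp leqNgt => /negP; apply.
apply: (@leq_ltn_trans (\dim (pspace q b + pspace q b'))).
  rewrite AE // -(rank_bmx_add e e') -!addsmxE mxrankS // addsmxS ?submxMl //.
have := dimv_sum_cap (pspace q b) (pspace q b'); rewrite e e'.
have := dimv_sum_cap (pspace p b) (pspace p b'); rewrite -/d -/d'; lia.
Qed.

(** A criterion for openness by separation: the complement may be taken to be
    the closure of the rest of [S]. *)
Lemma open_in_sep (S U : set (flag V n * flag V n)) :
    (forall p, U p -> S p) ->
    (forall p, U p -> exists P, [/\ multihomogeneous P, pval p P != 0 &
       forall q, S q -> ~ U q -> pval q P = 0]) ->
  open_in S U.
Proof.
move=> US sep.
pose Ps : set {mpoly k[nv]} :=
  [set P | multihomogeneous P /\ forall q, S q -> ~ U q -> pval q P = 0]%classic.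
exists [set q | forall P, Ps P -> pval q P = 0]%classic.
  by exists Ps => // P [].
apply/seteqP; split=> q /=.
  move=> Uq; split; first exact: US.
  move=> h; have [P [h1 h2 h3]] := sep q Uq.
  by rewrite h ?eqxx in h2.
by move=> [Sq nZ]; apply: contrapT => nU; apply: nZ => P [_ h]; apply: h.
Qed.

Lemma pspace_fl (p : flag V n * flag V n) s (i : 'I_n.+1) :
  pspace p (s, i) = fl (if s then p.1 else p.2) i.
Proof. by rewrite /pspace /fl /= (minn_idPl (ltn_ord i : (i <= n)%N)) inord_val. Qed.

End MultiHomogeneous.

Lemma SsetE (k : closedFieldType) (V : vectType k) n r (a b : summx n r)
    (p : flag V n * flag V n) : Sset a b p <->
  exists f, relpos p.1 f = natmx_of a /\ relpos f p.2 = natmx_of b.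
Proof. by split=> -[f [/eorbE h1 /eorbE h2]]; exists f. Qed.

(** The set of pairs with a middle flag consists of positions at most [c], so
    the orbit of [c] is singled out by the vanishing of no rank condition:
    multiply the separating polynomials for all pairs of steps. *)
Lemma prod_open (k : closedFieldType) (V : vectType k) n (a b c : summx n (\dim {:V})) :
  isprod a b c -> open_in (@Sset k V n _ a b) (@eorb k V n _ c).
Proof.
move=> pr; apply: open_in_sep => -[f1 f2] /eorbE e.
  by apply/SsetE; apply: prod_attained pr e.
pose B := ('I_n.+1 * 'I_n.+1)%type.
have /choice[P] : forall ij : B, exists P, exists d, [/\ mhom d P, pval (f1, f2) P != 0%R &
  forall q : flag V n * flag V n, \dim (fl q.1 ij.1) = \dim (fl f1 ij.1) ->
    \dim (fl q.2 ij.2) = \dim (fl f2 ij.2) ->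
    (\dim (fl f1 ij.1 :&: fl f2 ij.2) < \dim (fl q.1 ij.1 :&: fl q.2 ij.2))%N ->
  pval q P = 0%R].
  move=> [i j]; have [P [d [h1 h2 h3]]] := separating_poly (f1, f2) (true, i) (false, j).
  exists P, d; split=> // q; have := h3 q; rewrite !pspace_fl /=; exact.
move=> /choice[d hP].
exists (\prod_ij P ij)%R; split.
- have hd ij : mhom (d ij) (P ij) by have [] := hP ij.
  exact: mhom_multi (mhom_prod hd).
- rewrite /pval rmorph_prod; apply/prodf_neq0 => ij _.
  by have [_] := hP ij.
move=> [g1 g2] /SsetE[f /= [ea eb]] nU.
have [c' e'] := pos_exists g1 g2 (erefl (\dim {:V})).
have /(closorbE _ e')[h1 h2 h3] : closorb c g1 g2.
  by apply/(prod_closorb _ _ pr); exists f; [exists a | exists b].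
have [i [j [ni nj lt]]] : exists i j, [/\ (i <= n)%N, (j <= n)%N &
    (rksum (natmx_of c) i j < rksum (natmx_of c') i j)%N].
  apply: contrapT => nlt; apply: nU; apply/eorbE; rewrite e'; congr natmx_of.
  apply: mle_anti => //; split=> [i j ni nj|i ni|j nj]; rewrite ?h2 ?h3 //.
  by rewrite leqNgt; apply/negP => lt; apply: nlt; exists i, j.
have ni' : (i < n.+1)%N by []. have nj' : (j < n.+1)%N by [].
rewrite /pval rmorph_prod; apply/eqP/prodf_eq0.
exists (Ordinal ni', Ordinal nj') => //; apply/eqP.
have [_ _] := hP (Ordinal ni', Ordinal nj'); apply; rewrite /=.
- by rewrite (dim_fl_relpos e') // (dim_fl_relpos e) // h2.
- by rewrite (dim_fl_relpos_col e') // (dim_fl_relpos_col e) // h3.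
- by rewrite -!relpos_rk // e e'.
Qed.

(** * Uniqueness of the open orbit *)

Section Transitivity.
Variables (k : fieldType) (V : vectType k) (n : nat).
Local Notation r := (\dim {:V}).
Implicit Types (f : flag V n) (F : nat -> {vspace V}).
Local Open Scope ring_scope.

(** Choose a vector in each line [F b.+1 / F b], inside the smallest step of
    [f] that allows it. *)
Lemma adapted_basis F f : full F -> exists x : nat -> V,
  [/\ basis_of fullv (mkseq x r),
      forall a, (a <= r)%N -> F a = <<mkseq x a>>%VS &
      forall j, fl f j = <<[seq x b | b <- iota 0 r & (word F f b < j)%N]>>%VS].
Proof.
move=> Ff; set w := word F f.
have /choice[x xP] : forall b, exists v, (b < r)%N ->
    [/\ v \in F b.+1, v \in fl f (w b).+1 & v \notin F b].
  move=> b; case: (ltnP b r) => br; last by exists 0.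
  have := word_lt f (w b).+1 Ff br; rewrite -/w ltnSn => /esym/subvPn[v].
  by move=> /memv_capP[h1 h2] h3; exists v.
have FE a : (a <= r)%N -> F a = <<mkseq x a>>%VS.
  elim: a => [_|a IH ar].
    by rewrite /mkseq /= span_nil; apply/eqP; rewrite -dimv_eq0 full_dim.
  have [h1 _ h3] := xP a ar.
  rewrite mkseqS -cats1 span_cat span_seq1 -IH 1?ltnW //.
  apply/eqP; rewrite eq_sym eqEdim subv_add (full_mono Ff) //= -memvE h1 /=.
  by rewrite dim_add_line // !full_dim // ltnW.
have bX : basis_of fullv (mkseq x r).
  by rewrite basisEdim size_mkseq leqnn andbT -FE // full_top ?subvv.
exists x; split=> // j; apply/eqP; rewrite eq_sym eqEdim; apply/andP; split.
  apply/span_subvP => v /mapP[b]; rewrite mem_filter mem_iota /= => /andP[wj br] ->.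
  by have [_ h _] := xP b br; apply: subvP h; apply: fl_mono.
have : free [seq x b | b <- iota 0 r & (w b < j)%N].
  apply: (@catl_free _ _ [seq x b | b <- iota 0 r & predC (fun b => w b < j)%N b]).
  rewrite -map_cat (perm_free (Y := mkseq x r)) ?(basis_free bX) //.
  by apply: perm_map; rewrite perm_filterC.
rewrite /free => /eqP ->; rewrite size_map size_filter.
have -> : \dim (fl f j) = rk w r j by rewrite -dim_rk // (full_top Ff (leqnn _)) capfv.
rewrite /rk -(big_mkord xpredT (fun b => (w b < j)%N : nat)) /index_iota subn0.
by rewrite -sum1_count [X in (_ <= X)%N]big_mkcond leq_sum.
Qed.

Lemma full_rank_ker (g : 'End(V)) : (fullv <= g @: fullv)%VS -> lker g == 0%VS.
Proof.
move=> h; rewrite -dimv_eq0; have := limg_ker_dim g fullv; rewrite capfv.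
by have := dimvS h; lia.
Qed.

(** Pairs in the same position can be refined to have the same word, and then
    adapted bases correspond to each other. *)
Lemma relpos_transitive f1 f2 f1' f2' : relpos f1 f2 = relpos f1' f2' ->
  exists2 g : 'End(V), lker g == 0%VS &
    forall j, fl f1' j = (g @: fl f1 j)%VS /\ fl f2' j = (g @: fl f2 j)%VS.
Proof.
move=> e; have [A eA] := pos_exists f1 f2 (erefl r); have [w rw] := rep_exists A.
have eA' : relpos f1' f2' = natmx_of A by rewrite -e.
have [F [Ff rf Fw]] := refines_maximal eA rw.
have [F' [Ff' rf' Fw']] := refines_maximal eA' rw.
have [x [bx Fx fx]] := adapted_basis f2 Ff.
have [y [bY Fy fy]] := adapted_basis f2' Ff'.
have [g0 g0E] := linear_of_free (mkseq x r) (mkseq y r).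
pose g := linfun g0.
have gx b : (b < r)%N -> g (x b) = y b.
  move=> br; rewrite lfunE.
  have := g0E (basis_free bx); rewrite !size_mkseq => /(_ erefl).
  by rewrite -map_comp => /eq_in_map/(_ b); apply; rewrite mem_iota.
have mapE s : all (fun b => b < r)%N s -> [seq g v | v <- map x s] = map y s.
  by move=> /allP h; rewrite -map_comp; apply/eq_in_map => c /h cr; apply: gx.
have all_iota a : (a <= r)%N -> all (fun b => b < r)%N (iota 0 a).
  by move=> ar; apply/allP => b; rewrite mem_iota /= => h; apply: leq_trans h ar.
have gF a : (a <= r)%N -> F' a = (g @: F a)%VS.
  by move=> ar; rewrite Fx // Fy // limg_span mapE // all_iota.
have f1E i : (i <= n)%N -> fl f1' i = (g @: fl f1 i)%VS.
  move=> ni; rewrite rf' // (dim_fl_relpos eA') // rf // (dim_fl_relpos eA) //.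
  by rewrite gF // rksum_le.
exists g.
  apply: full_rank_ker; have := gF r (leqnn r).
  by rewrite (full_top Ff' (leqnn r)) (full_top Ff (leqnn r)) => <-; apply: subvv.
move=> j; split; last first.
  rewrite fx fy limg_span mapE ?Fw ?Fw' //.
  by apply/allP => b; rewrite mem_filter mem_iota => /andP[_].
have [nj|jn] := leqP j n; first exact: f1E.
have := f1E n (leqnn n).
by rewrite !(fl_full _ (leqnn n)) !(fl_full _ (ltnW jn)).
Qed.

Lemma flag_image (g : 'End(V)) f : lker g == 0%VS -> exists f', forall j, fl f' j = (g @: fl f j)%VS.
Proof.
move=> kg; have [||j jn|f' fE] := @flag_of_chain _ _ n (fun j => g @: fl f j)%VS.
- by rewrite fl0 limg0.
- by rewrite fl_full // lker0_limgf.
- by rewrite limgS // flS.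
exists f' => j; have [nj|jn] := leqP j n; first exact: fE.
by rewrite !(fl_full _ (ltnW jn)) lker0_limgf.
Qed.

Lemma relpos_image (g : 'End(V)) f1 f2 f1' f2' : lker g == 0%VS ->
    (forall j, fl f1' j = (g @: fl f1 j)%VS) -> (forall j, fl f2' j = (g @: fl f2 j)%VS) ->
  relpos f1' f2' = relpos f1 f2.
Proof.
move=> kg e1 e2; apply: rksum_inj => i j ni nj; rewrite !relpos_rk // e1 e2.
by rewrite -lker0_img_cap // limg_dim_eq // (eqP kg) capv0.
Qed.

End Transitivity.

Section PolyFun.
Variable k : fieldType.
Implicit Types (h : k -> k).
Local Open Scope ring_scope.

(** Stated for functions because determinants and values of polynomials depend
    on the parameter as functions. *)
Definition polyfun h := exists p : {poly k}, forall t, h t = p.[t].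

Lemma polyfunC c : polyfun (fun=> c).
Proof. by exists c%:P => t; rewrite hornerC. Qed.

Lemma polyfun_id : polyfun id.
Proof. by exists 'X => t; rewrite hornerX. Qed.

Lemma polyfunD h h' : polyfun h -> polyfun h' -> polyfun (fun t => h t + h' t).
Proof. by move=> [p e] [p' e']; exists (p + p') => t; rewrite hornerD e e'. Qed.

Lemma polyfunM h h' : polyfun h -> polyfun h' -> polyfun (fun t => h t * h' t).
Proof. by move=> [p e] [p' e']; exists (p * p') => t; rewrite hornerM e e'. Qed.

Lemma eq_polyfun h h' : h =1 h' -> polyfun h -> polyfun h'.
Proof. by move=> e [p pE]; exists p => t; rewrite -e. Qed.

Lemma polyfun_sum (I : Type) (s : seq I) (P : pred I) (F : I -> k -> k) :
  (forall i, polyfun (F i)) -> polyfun (fun t => \sum_(i <- s | P i) F i t).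
Proof.
move=> h; elim: s => [|i s IH].
  by apply: eq_polyfun (polyfunC 0) => t; rewrite big_nil.
case Pi: (P i); last by apply: eq_polyfun IH => t; rewrite big_cons Pi.
by apply: eq_polyfun (polyfunD (h i) IH) => t; rewrite big_cons Pi.
Qed.

Lemma polyfun_prod (I : Type) (s : seq I) (P : pred I) (F : I -> k -> k) :
  (forall i, polyfun (F i)) -> polyfun (fun t => \prod_(i <- s | P i) F i t).
Proof.
move=> h; elim: s => [|i s IH].
  by apply: eq_polyfun (polyfunC 1) => t; rewrite big_nil.
case Pi: (P i); last by apply: eq_polyfun IH => t; rewrite big_cons Pi.
by apply: eq_polyfun (polyfunM (h i) IH) => t; rewrite big_cons Pi.
Qed.

Lemma polyfunX h m : polyfun h -> polyfun (fun t => h t ^+ m).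
Proof.
move=> ph; elim: m => [|m IH].
  by apply: eq_polyfun (polyfunC 1) => t; rewrite expr0.
by apply: eq_polyfun (polyfunM ph IH) => t; rewrite exprS.
Qed.

Lemma polyfun_det m (M : k -> 'M[k]_m) :
  (forall a b, polyfun (fun t => M t a b)) -> polyfun (fun t => \det (M t)).
Proof.
move=> h; apply: polyfun_sum => s; apply: polyfunM; first exact: polyfunC.
exact: polyfun_prod.
Qed.

Lemma polyfun_meval m (P : {mpoly k[m]}) (x : k -> 'I_m -> k) :
  (forall i, polyfun (x^~ i)) -> polyfun (fun t => P.@[x t]).
Proof.
move=> h; apply: (@eq_polyfun (fun t => \sum_(m <- msupp P) P@_m * \prod_i x t i ^+ m i)).
  by move=> t; rewrite mevalE.
apply: polyfun_sum => mm; apply: polyfunM; first exact: polyfunC.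
by apply: polyfun_prod => i; apply: polyfunX.
Qed.

End PolyFun.

(** Over an infinite field a product of nonzero polynomials has a nonroot. *)
Lemma polyfun_common (k : closedFieldType) (h1 h2 h3 : k -> k) :
    polyfun h1 -> polyfun h2 -> polyfun h3 ->
    (exists t, h1 t != 0)%R -> (exists t, h2 t != 0)%R -> (exists t, h3 t != 0)%R ->
  exists t, [/\ h1 t != 0, h2 t != 0 & h3 t != 0]%R.
Proof.
move=> [p1 e1] [p2 e2] [p3 e3] [t1 n1] [t2 n2] [t3 n3].
have nz p (h : k -> k) t : (forall t, h t = p.[t])%R -> (h t != 0)%R -> (p != 0)%R.
  by move=> e; apply: contraNneq => p0; rewrite e p0 horner0.
have : (p1 * p2 * p3 != 0)%R by rewrite !mulf_neq0 // ?(nz _ _ _ e1 n1) ?(nz _ _ _ e2 n2) ?(nz _ _ _ e3 n3).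
move=> /closed_nonrootP[t]; rewrite /root !hornerM !mulf_eq0 !negb_or -e1 -e2 -e3.
by move=> /andP[/andP[]]; exists t.
Qed.

Section Scaling.
Variables (k : fieldType) (V : vectType k) (n : nat).
Local Open Scope ring_scope.

Lemma multihom_scale (P : {mpoly k[#|pvar V n|]}) (c : Defs.pblock n -> k) (x y : pvar V n -> k) :
    multihomogeneous P -> (forall b, c b != 0) -> (forall v, x v = c v.1 * y v) ->
  (P.@[fun i => x (enum_val i)] != 0) = (P.@[fun i => y (enum_val i)] != 0).
Proof.
move=> hP cn xy; have /choice[d dP] := hP.
suff -> : P.@[fun i => x (enum_val i)] =
    \prod_b c b ^+ d b * P.@[fun i => y (enum_val i)].
  rewrite mulf_eq0 negb_or andb_idl // => _.
  by apply/prodf_neq0 => b _; rewrite expf_neq0.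
rewrite !mevalE mulr_sumr; apply: eq_big_seq => m mP.
rewrite mulrCA; congr (_ * _).
have -> : \prod_b c b ^+ d b = \prod_i c (enum_val i).1 ^+ m i.
  rewrite (reindex (@enum_rank (pvar V n))) /=; last first.
    by apply: onW_bij; apply: enum_rank_bij.
  transitivity (\prod_b \prod_(T : {set 'I_(\dim {:V})}) c b ^+ m (enum_rank ((b, T) : pvar V n))).
    by apply: eq_bigr => b _; rewrite -(dP b m mP) -prodrXr.
  by rewrite pair_big; apply: eq_bigr => -[b T] _; rewrite enum_rankK.
by rewrite -big_split; apply: eq_bigr => i _; rewrite xy exprMn.
Qed.

End Scaling.

Section Curve.
Variables (k : closedFieldType) (V : vectType k) (n : nat).
Local Notation N := (\dim {:V}).
Local Notation e := (vbasis {:V}).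
Implicit Types (f : flag V n).
Local Open Scope ring_scope.

Lemma fl_val f (i : 'I_n.+1) : val f i = fl f i.
Proof. by rewrite /fl (minn_idPl (ltn_ord i : (i <= n)%N)) inord_val. Qed.

Lemma lker_det (g : 'End(V)) : (lker g == 0%VS) = (\det (mxof e e g) != 0).
Proof.
rewrite (lker_ker (vbasisP _)) vsof_eq0 ?vbasisP // kermx_eq0 row_free_unit.
by rewrite unitmxE unitfE.
Qed.

Variables (u v : 'End(V)).

Definition segment (t : k) : 'End(V) := u + t *: (v - u).

Lemma segmentE t x : segment t x = u x + t *: (v x - u x).
Proof. by rewrite /segment add_lfunE scale_lfunE add_lfunE opp_lfunE. Qed.

Lemma polyfun_segment x c : polyfun (fun t => coord e c (segment t x)).
Proof.
apply: (@eq_polyfun _ (fun t => coord e c (u x) + t * coord e c (v x - u x))).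
  by move=> t; rewrite segmentE [RHS]linearD [in RHS]linearZ.
apply: polyfunD; first exact: polyfunC.
by apply: polyfunM; [apply: polyfun_id | apply: polyfunC].
Qed.

Lemma polyfun_det_segment : polyfun (fun t => \det (mxof e e (segment t))).
Proof.
apply: polyfun_det => a b.
apply: eq_polyfun (polyfun_segment e`_a b) => t.
by rewrite /mxof !mxE /= vecof_delta.
Qed.

Lemma polyfun_plc (Y : seq V) T : polyfun (fun t => plc (map (segment t) Y) T).
Proof.
rewrite /plc; have [sT|nT] := eqVneq #|T| (size Y); last first.
  by apply: eq_polyfun (polyfunC 0) => t; rewrite size_map (negPf nT).
apply: (@eq_polyfun _ (fun t => \det (\matrix_(a < #|T|, b < #|T|)
  coord e (enum_val b) (map (segment t) Y)`_a))).
  by move=> t; rewrite size_map ifT // sT.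
apply: polyfun_det => a b; apply: eq_polyfun (polyfun_segment Y`_a (enum_val b)) => t.
by rewrite mxE (nth_map 0) // -sT.
Qed.

Variables (f1 f2 : flag V n).

(** Homogeneous coordinates of the pair formed by [f1] and the image of [f2]
    under the endomorphism of parameter [t], up to a nonzero scalar in each
    block; they are polynomial in [t], and they make sense even if this
    endomorphism is singular. *)
Definition curve_coord (t : k) (x : pvar V n) : k :=
  let: (s, i, T) := x in
  if s then plucker (val f1 i) T else plc (map (segment t) (vbasis (val f2 i))) T.

Definition curve_val (P : {mpoly k[#|pvar V n|]}) t := P.@[fun i => curve_coord t (enum_val i)].

Lemma polyfun_curve P : polyfun (curve_val P).
Proof.
apply: polyfun_meval => i; case: (enum_val i) => -[[] j] T /=.
  exact: polyfunC.
exact: polyfun_plc.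
Qed.

Lemma curve_pval P t g : multihomogeneous P -> lker (segment t) == 0%VS ->
    (forall j, fl g j = (segment t @: fl f2 j)%VS) ->
  (pval (f1, g) P != 0) = (curve_val P t != 0).
Proof.
move=> hP kt gE.
have /choice[c cP] : forall b : Defs.pblock n, exists c, c != 0 /\
    forall T, pcoord (f1, g) (b, T) = c * curve_coord t (b, T).
  move=> [[] i] /=; first by exists 1; split=> [|T]; rewrite ?oner_eq0 ?mul1r.
  have bY : basis_of (val g i) (map (segment t) (vbasis (val f2 i))).
    rewrite !fl_val gE; apply: limg_basis_of (vbasisP _).
    by rewrite (eqP kt) capv0.
  by have [c c0 h] := plucker_basis bY; exists c.
rewrite /pval /curve_val; apply: (multihom_scale hP (c := c)) => [b|[b T]].
  by have [] := cP b.
by have [_] := cP b; apply.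
Qed.

End Curve.

Lemma not_closedP (k : fieldType) (V : vectType k) n (Z : set (flag V n * flag V n)) p :
  zariski_closed Z -> ~ Z p -> exists P, [/\ multihomogeneous P, pval p P != 0%R &
    forall q, pval q P != 0%R -> ~ Z q].
Proof.
move=> [Ps hPs ZE]; rewrite ZE => /existsNP[P /not_implyP[PsP nz]].
exists P; split; [exact: hPs | exact/eqP |].
by move=> q /eqP nq; rewrite ZE => /(_ P PsP).
Qed.

(** The set of pairs is irreducible. Take pairs (f1, f2) and (f1', f2') in the
    two orbits, with middle flags f and f'. Choose [u] that moves f1' and f'
    to f1 and f, and [v] that moves f' and f2' to f and f2. An endomorphism on
    the line through [u] and [v] still maps f' into f. So, together with f1,
    the image of f2' under it gives a pair in the set whenever it is
    invertible. This curve meets both open sets, hence so does a general point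
    of it. *)
Lemma open_unique (k : closedFieldType) (V : vectType k) n (a b c c' : summx n (\dim {:V})) :
    open_in (@Sset k V n _ a b) (@eorb k V n _ c) ->
    open_in (@Sset k V n _ a b) (@eorb k V n _ c') -> c = c'.
Proof.
move=> [Z cZ eZ] [Z' cZ' eZ'].
have inS p : eorb c p -> Sset a b p /\ ~ Z p by rewrite eZ.
have inS' p : eorb c' p -> Sset a b p /\ ~ Z' p by rewrite eZ'.
have [f1 [f2 ec]] := relpos_realized c; have [f1' [f2' ec']] := relpos_realized c'.
have [/SsetE[f /= [fa fb]] nZ] := inS _ (proj2 (eorbE _ _ _) ec).
have [/SsetE[f' /= [fa' fb']] _] := inS' _ (proj2 (eorbE _ _ _) ec').
have [u ku uE] : exists2 u : 'End(V), lker u == 0%VS & forall j,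
    fl f1 j = (u @: fl f1' j)%VS /\ fl f j = (u @: fl f' j)%VS.
  by apply: relpos_transitive; rewrite fa fa'.
have [v kv vE] : exists2 v : 'End(V), lker v == 0%VS & forall j,
    fl f j = (v @: fl f' j)%VS /\ fl f2 j = (v @: fl f2' j)%VS.
  by apply: relpos_transitive; rewrite fb fb'.
have s0 : segment u v 0%R = u by rewrite /segment scale0r addr0.
have s1 : segment u v 1%R = v by rewrite /segment scale1r addrC subrK.
have [q0 q0E] := flag_image f2' ku.
have ec0 : relpos f1 q0 = natmx_of c'.
  by rewrite -ec'; apply: relpos_image ku _ q0E => j; have [] := uE j.
have [_ nZ'] := inS' _ (proj2 (eorbE _ _ _) ec0).
have [P [hP P1 PZ]] := not_closedP cZ nZ.
have [P' [hP' P0 PZ']] := not_closedP cZ' nZ'.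
have [||| t [n1 n2 n3]] := polyfun_common (polyfun_curve u v f1 f2' P)
  (polyfun_curve u v f1 f2' P') (polyfun_det_segment u v).
- have e1 j : fl f2 j = (segment u v 1%R @: fl f2' j)%VS by rewrite s1; have [] := vE j.
  by exists 1%R; rewrite -(curve_pval _ hP _ e1) ?s1.
- have e0 j : fl q0 j = (segment u v 0%R @: fl f2' j)%VS by rewrite s0.
  by exists 0%R; rewrite -(curve_pval _ hP' _ e0) ?s0.
- by exists 1%R; rewrite s1 -lker_det.
have kt : lker (segment u v t) == 0%VS by rewrite lker_det.
have [g gE] := flag_image f2' kt.
(* Both [u] and [v] map f' onto f. *)
have fE j : fl f j = (segment u v t @: fl f' j)%VS.
  apply/esym/eqP; rewrite eqEdim; apply/andP; split; last first.
    rewrite limg_dim_eq; last by rewrite (eqP kt) capv0.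
    have [_ ->] := uE j; rewrite limg_dim_eq ?leqnn // (eqP ku) capv0 //.
  apply/subvP => _ /memv_imgP[x xf ->]; rewrite segmentE.
  have ux : u x \in fl f j by have [_ ->] := uE j; apply: memv_img.
  have vx : v x \in fl f j by have [-> _] := vE j; apply: memv_img.
  by rewrite memvD // memvZ // memvB.
have Sg : Sset a b (f1, g).
  apply/SsetE; exists f; split=> //=; rewrite -fb'.
  exact: relpos_image kt fE gE.
have : eorb c (f1, g).
  by rewrite eZ; split=> //; apply: PZ; rewrite (curve_pval _ hP kt gE).
have : eorb c' (f1, g).
  by rewrite eZ'; split=> //; apply: PZ'; rewrite (curve_pval _ hP' kt gE).
by move=> /eorbE e1 /eorbE e2; apply: natmx_of_inj; rewrite -e1 -e2.
Qed.

Lemma generic_scE (k : closedFieldType) (V : vectType k) n (a b c : summx n (\dim {:V})) :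
  generic_sc V a b c = indic (open_in (@Sset k V n _ a b) (eorb c)).
Proof. by []. Qed.

Lemma generic_sc_prod (k : closedFieldType) (V : vectType k) n (a b c d : summx n (\dim {:V})) :
  isprod a b d -> generic_sc V a b c = indic (c = d).
Proof.
move=> pr; have op := prod_open pr; rewrite generic_scE; apply: indic_iff.
by split=> [oc|->//]; apply: open_unique oc op.
Qed.

Lemma generic_sc_incompat (k : closedFieldType) (V : vectType k) n (a b c : summx n (\dim {:V})) :
  ~ compat a b -> generic_sc V a b c = 0%R.
Proof.
move=> nab; rewrite generic_scE indic0 // => -[Z _ eZ].
have [f1 [f2 ec]] := relpos_realized c.
have : eorb c (f1, f2) by apply/eorbE.
rewrite eZ => -[/SsetE[f /= [fa fb]] _]; apply: nab.
by apply: (@compat_of_mid _ _ _ a b f1 f f2); [exists a | exists b].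
Qed.

(** * The isomorphism *)

(** The zeta transform of the order [le]; the basis element of [a] is sent to
    the sum of those of all [b] below [a]. *)
Definition zeta (T : finType) (le : T -> T -> Prop) (x : {ffun T -> int^o}) :
    {ffun T -> int^o} :=
  [ffun b => \sum_a indic (le b a) * x a].

Lemma zeta_linear (T : finType) (le : T -> T -> Prop) : linear (zeta le).
Proof.
move=> c x y; apply/ffunP => b; rewrite !ffunE scaler_sumr -big_split.
by apply: eq_bigr => a _; rewrite !ffunE mulrDr /GRing.scale /= mulrCA.
Qed.

HB.instance Definition _ (T : finType) (le : T -> T -> Prop) :=
  GRing.isLinear.Build int {ffun T -> int^o} {ffun T -> int^o} *:%R (zeta le) (@zeta_linear T le).

(** The transform is unitriangular for [mu]. To solve [zeta le x = y],
    subtract the transform of [y] from [y]; the remainder is supported where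
    [mu] is larger. *)
Lemma zeta_bijective (T : finType) (le : T -> T -> Prop) (mu : T -> nat) :
    (forall a, le a a) -> (forall a b, le b a -> b <> a -> (mu a < mu b)%N) ->
  bijective (zeta le).
Proof.
move=> rf mono.
have diag (x : {ffun T -> int^o}) b : (forall a, le b a -> b <> a -> x a = 0) -> zeta le x b = x b.
  move=> h; rewrite ffunE (bigD1 b) //= indic1 // mul1r big1 ?addr0 // => a /eqP nab.
  have [l|nl] := pselect (le b a); last by rewrite indic0 ?mul0r.
  by rewrite h ?mulr0 // => /esym.
have inj : injective (zeta le).
  apply: raddf_inj => x x0; apply/ffunP => b; rewrite ffunE.
  have [m] := ubnP (mu b); elim: m b => // m IH b hb.
  rewrite -diag ?x0 ?ffunE // => a l nab; apply: IH.
  by have := mono _ _ l nab; lia.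
have surj m : forall y : {ffun T -> int^o},
    (forall a, y a != 0 -> (\max_b mu b < mu a + m)%N) -> exists x, zeta le x = y.
  elim: m => [|m IH] y h.
    exists 0; rewrite raddf0; apply/ffunP => a; rewrite ffunE; apply/esym/eqP/negPn/negP => nz.
    by have := h a nz; have := leq_bigmax (F := mu) a; lia.
  have [|x xE] := IH (y - zeta le y).
    move=> a; rewrite 2!ffunE => nz; rewrite ltnNge; apply/negP => le_.
    case/eqP: nz; apply/eqP; rewrite diag ?subrr // => b l nb.
    apply/eqP/negPn/negP => /h; have := mono _ _ l nb; lia.
  by exists (y + x); rewrite raddfD /= xE addrC subrK.
have sur y : exists x, zeta le x = y.
  by apply: (surj (\max_b mu b).+1) => a _; lia.
have [g gK] := choice sur.
by exists g => // x; apply: inj; rewrite gK.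
Qed.

Definition rktotal n r (A : summx n r) : nat :=
  (\sum_(i < n.+1) \sum_(j < n.+1) rksum (natmx_of A) i j)%N.

(** Smaller positions have larger ranks. *)
Lemma rktotal_mono n r (A B : summx n r) : mle B A -> B <> A ->
  (rktotal A < rktotal B)%N.
Proof.
move=> [h h2 h3] ne; have le : (rktotal A <= rktotal B)%N.
  by apply: leq_sum => i _; apply: leq_sum => j _; apply: h; rewrite -ltnS.
rewrite ltn_neqAle le andbT; apply/negP => /eqP e; apply: ne.
apply/natmx_of_inj/rksum_inj => i j ni nj.
have lei (a b : 'I_n.+1) :
    (rksum (natmx_of A) a b <= rksum (natmx_of B) a b ?= iff
     (rksum (natmx_of A) a b == rksum (natmx_of B) a b))%N.
  by split=> //; apply: h; rewrite -ltnS.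
have rowi (a : 'I_n.+1) := @leqif_sum _ xpredT _ _ _ (fun b _ => lei a b).
have [_] := @leqif_sum _ xpredT _ _ _ (fun a _ => rowi a).
have ni' : (i < n.+1)%N by []. have nj' : (j < n.+1)%N by [].
rewrite -/(rktotal A) -/(rktotal B) e eqxx => /esym/forallP/(_ (Ordinal ni')).
by move=> /forallP/(_ (Ordinal nj')) /= /eqP.
Qed.

(** The condition for the transform to be multiplicative, on structure
    constants. *)
Lemma structure_constants (k : closedFieldType) (V : vectType k) n (a b c : summx n (\dim {:V})) :
  \sum_d indic (mle c d) * generic_sc V a b d = zero_sum a b c.
Proof.
have [ab|nab] := pselect (compat a b); last first.
  by rewrite zero_sum_incompat // big1 // => d _; rewrite generic_sc_incompat ?mulr0.
have [d [pr]] := isprod_exists ab; rewrite (zero_sum_prod c pr).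
rewrite (bigD1 d) //= (generic_sc_prod _ pr) (@indic1 (d = d)) // mulr1 big1 ?addr0 // => d' /eqP nd.
by rewrite (generic_sc_prod _ pr) (indic0 nd) mulr0.
Qed.

Theorem theorem1 (n r : nat) (n_ge1 : (1 <= n)%N) (r_ge1 : (1 <= r)%N)
    (k : closedFieldType) (V : vectType k) (dimV : \dim {:V} = r) :
  scisomorphic (generic_alg V n r) (zeroSchur n r).
Proof.
subst r; exists (zeta (@mle n (\dim {:V}))); split.
  by apply: (zeta_bijective (mu := @rktotal n _)); [apply: mle_refl | move=> a b; apply: rktotal_mono].
move=> x y; apply/ffunP => c; rewrite !ffunE.
transitivity (\sum_a \sum_b x a * y b * zero_sum a b c).
  under eq_bigr do rewrite ffunE mulr_sumr.
  rewrite exchange_big; apply: eq_bigr => a _.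
  under eq_bigr do rewrite mulr_sumr.
  rewrite exchange_big; apply: eq_bigr => b _.
  by rewrite -structure_constants mulr_sumr; apply: eq_bigr => d _; rewrite mulrCA.
transitivity (\sum_a' \sum_b' \sum_a \sum_b x a * y b *
   (indic (mle a' a) * indic (mle b' b) * (hall_poly a' b' c).[0])).
  under eq_bigr do under eq_bigr do rewrite /zero_sum mulr_sumr.
  under eq_bigr do under eq_bigr do under eq_bigr do rewrite mulr_sumr.
  rewrite pair_bigA exchange_big; apply: eq_bigr => a' _.
  rewrite exchange_big; apply: eq_bigr => b' _.
  by rewrite pair_bigA.
apply: eq_bigr => a' _; apply: eq_bigr => b' _; rewrite !ffunE.
rewrite mulr_suml mulr_suml; apply: eq_bigr => a _.
rewrite mulr_sumr mulr_suml; apply: eq_bigr => b _.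
rewrite /= /horner_eval; ring.
Qed.
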